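(* Let $G$ be a (simple) graph with maximum degree $\Delta\leq 3$. Then all $(\Delta+1)$-edge-colourings of $G$ are Kempe equivalent.
   Context: A $k$-edge-colouring of a graph $G$ is an assignment of colours from $\{1,\ldots,k\}$ to the edges of $G$ such that adjacent edges (edges sharing an endpoint) receive different colours. Given a $k$-edge-colouring and two colours $a,b$, the edges coloured $a$ or $b$ form a subgraph whose components are paths and cycles alternating in $a$ and $b$; a Kempe change is the operation of interchanging $a$ and $b$ on one such connected component, which yields another $k$-edge-colouring. Two $k$-edge-colourings are Kempe equivalent if one can be obtained from the other by a sequence of Kempe changes; colourings differing only by a permutation of the colours are regarded as the same colouring. *)

(* Defs.v *)
From mathcomp Require Import all_boot perm.
Set Implicit Arguments.
Unset Strict Implicit.
Unset Printing Implicit Defensive.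

Record sgraph := SGraph {
  svertex :> finType;
  sedge : rel svertex;
  sedge_sym : symmetric sedge;
  sedge_irrefl : irreflexive sedge }.

Definition degree (G : sgraph) (x : G) : nat := #|[set y | sedge x y]|.

Definition max_degree (G : sgraph) : nat := \max_(x : G) degree x.

Definition edges (G : sgraph) : {set {set G}} :=
  [set f : {set G} | [exists x, exists y, sedge x y && (f == [set x; y])]].

Definition edge (G : sgraph) := {f : {set G} | f \in edges G}.

Definition adjacent (G : sgraph) (f g : edge G) : bool :=
  (f != g) && (val f :&: val g != set0).

Definition proper_colouring (G : sgraph) (k : nat)
    (c : {ffun edge G -> 'I_k}) : bool :=
  [forall f, forall g, adjacent f g ==> (c f != c g)].

Definition colouring (G : sgraph) (k : nat) :=
  {c : {ffun edge G -> 'I_k} | proper_colouring c}.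

(* Adjacency in the spanning subgraph of G whose edges are those coloured a
   or b. *)
Definition kempe_rel (G : sgraph) (k : nat) (c : {ffun edge G -> 'I_k})
    (a b : 'I_k) : rel G :=
  [rel x y | [exists f : edge G,
                (val f == [set x; y]) && (c f \in [set a; b])]].

(* The edge set of the component of that subgraph containing the vertex v. It
   is empty when no edge at v is coloured a or b; the corresponding Kempe
   change is then the identity. *)
Definition kempe_component (G : sgraph) (k : nat) (c : {ffun edge G -> 'I_k})
    (a b : 'I_k) (v : G) : {set edge G} :=
  [set f : edge G | (c f \in [set a; b]) &&
     [forall x in val f, connect (kempe_rel c a b) v x]].

Definition kempe_swap (G : sgraph) (k : nat) (c : {ffun edge G -> 'I_k})
    (a b : 'I_k) (v : G) : {ffun edge G -> 'I_k} :=
  [ffun f => if f \in kempe_component c a b v then tperm a b (c f) else c f].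

Definition kempe_change (G : sgraph) (k : nat) (c d : colouring G k) : bool :=
  [exists a, exists b, exists v : G,
     (a != b) && (val d == kempe_swap (val c) a b v)].

Definition same_up_to_perm (G : sgraph) (k : nat) (c d : colouring G k) : bool :=
  [exists s : {perm 'I_k}, [forall f : edge G, sval d f == s (sval c f)]].

(* Kempe equivalence, with colourings that differ by a permutation of the
   colours identified: a finite sequence of steps, each of them a Kempe change
   or a renaming of the colours. Both kinds of step are reversible. *)
Definition kempe_equiv (G : sgraph) (k : nat) (c d : colouring G k) : bool :=
  connect [rel c1 c2 : colouring G k |
             kempe_change c1 c2 || same_up_to_perm c1 c2] c d.

(* Main.v *)
Require Import Defs.
From mathcomp Require Import all_boot perm.
From Stdlib Require Import FunctionalExtensionality.
Set Implicit Arguments.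
Unset Strict Implicit.
Unset Printing Implicit Defensive.

(* Colourings of a graph with k = Delta + 1 <= 4 colours are compared by
   induction on the number of edges.

   If some vertex v has degree 1 or 2, delete one edge vx.  The rest of the
   graph leaves a common colour for vx at both ends, and every swap of the
   smaller graph lifts: if the swapped colours a, b are the only common ones,
   then v or x meets neither a nor b.

   Otherwise the graph is cubic and k = 4; delete a vertex v.  Every neighbour
   of v then misses two colours, which gives three lists of size two.

   - If some colour lies in an odd number of lists, all extensions of the
     colouring to v are equivalent.
   - If every colour lies in an even number of lists (the lists form a triangle)
     there are two extensions, but every swap relates both of them to extensions
     of the new colouring.  As all colourings of G - v are equivalent, the two
     extensions are equivalent as soon as G - v has one colouring that is not
     even.
   - If the three lists coincide there is no extension.  The role of the
     extensions is played by those of the colourings one swap away (predicate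
     near).  They are all equivalent: view the colouring as one of G minus an
     edge vx, and move this hole along an alternating chain until the three
     lists at its end no longer coincide. *)

(** * Colourings, swaps and chains *)

Section Colourings.
Variables (T C : finType).
Implicit Types (a b s t : C) (x y z v w : T) (K : {set T}).

(* Partial edge colourings of the complete graph on T: the colour_pairs with colour
   None are non-edges, so a colouring carries its own graph. *)
Definition col := T -> T -> option C.
Implicit Types (c d f g h : col).

Definition pcol c := [/\ forall x y, c x y = c y x, forall x, c x x = None &
  forall x y z a, c x y = Some a -> c x z = Some a -> y = z].

Definition swc a b s := if s == a then b else if s == b then a else s.
Definition tch a b (o : option C) := (o == Some a) || (o == Some b).
Definition kclosed a b K c :=
  forall x y, tch a b (c x y) -> (x \in K) = (y \in K).
(** Testing one end is enough: on a [kclosed] set both ends of an edge coloured [a] or [b] lie on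
    the same side, and [swc] fixes all other colours. *)
Definition swap a b K c : col :=
  fun x y => if x \in K then omap (swc a b) (c x y) else c x y.

(* Swaps are allowed on any union of components. *)
Inductive keq c : col -> Prop :=
| keq_refl : keq c c
| keq_snoc d a b K : keq c d -> kclosed a b K d -> keq c (swap a b K d).

Definition misses c x a := [forall y, c x y != Some a].

Lemma col_ext c d : (forall x y, c x y = d x y) -> c = d.
Proof.
by move=> e; apply: functional_extensionality => x;
  apply: functional_extensionality => y.
Qed.

Lemma swcK a b : involutive (swc a b).
Proof.
rewrite /swc => s; case: (s =P a) => [->|sa].
  by rewrite eqxx; case: eqP => // ->.
case: (s =P b) => [->|sb]; first by rewrite eqxx.
by case: (s =P a) => // _; case: (s =P b).
Qed.

Lemma swcC a b s : swc a b s = swc b a s.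
Proof. by rewrite /swc; case: (s =P a) => [->|//]; case: (a =P b). Qed.

Lemma swcL a b : swc a b a = b. Proof. by rewrite /swc eqxx. Qed.
Lemma swcR a b : swc a b b = a. Proof. by rewrite swcC swcL. Qed.

Lemma swc_id a b s : s != a -> s != b -> swc a b s = s.
Proof. by rewrite /swc => /negPf-> /negPf->. Qed.

Lemma swc_eq a b s t : (swc a b s == t) = (s == swc a b t).
Proof. exact: inv_eq (swcK a b) _ _. Qed.

Lemma tch_Some a b s : tch a b (Some s) = (s == a) || (s == b).
Proof. by []. Qed.

Lemma omap_swc_eq a b o s :
  (omap (swc a b) o == Some s) = (o == Some (swc a b s)).
Proof. by case: o => //= t; rewrite !(inj_eq Some_inj) swc_eq. Qed.

Lemma tch_swc a b o : tch a b (omap (swc a b) o) = tch a b o.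
Proof. by rewrite /tch !omap_swc_eq swcL swcR orbC. Qed.

Lemma omap_swc_id a b o : ~~ tch a b o -> omap (swc a b) o = o.
Proof.
by case: o => //= s; rewrite tch_Some negb_or => /andP[sa sb]; rewrite swc_id.
Qed.

Lemma tchC a b o : tch a b o = tch b a o. Proof. exact: orbC. Qed.

Lemma kclosedC a b K c : kclosed a b K c -> kclosed b a K c.
Proof. by move=> cl x y; rewrite tchC; apply: cl. Qed.

Lemma swapC a b K c : swap a b K c = swap b a K c.
Proof.
apply: col_ext => x y; rewrite /swap; case: ifP => // _.
by case: (c x y) => //= s; rewrite swcC.
Qed.

Lemma kclosedI a b K K' c : kclosed a b K c -> kclosed a b K' c ->
  kclosed a b (K :&: K') c.
Proof. by move=> cl cl' x y e; rewrite !inE (cl _ _ e) (cl' _ _ e). Qed.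

Lemma kclosed_compl a b K c : kclosed a b K c -> kclosed a b (~: K) c.
Proof. by move=> cl x y e; rewrite !inE (cl _ _ e). Qed.

Definition symdiff K K' := [set x | (x \in K) (+) (x \in K')].

Lemma kclosed_symdiff a b K K' c : kclosed a b K c -> kclosed a b K' c ->
  kclosed a b (symdiff K K') c.
Proof. by move=> cl cl' x y e; rewrite !inE (cl _ _ e) (cl' _ _ e). Qed.

Lemma tch_swap a b K c x y : tch a b (swap a b K c x y) = tch a b (c x y).
Proof. by rewrite /swap; case: ifP => // _; apply: tch_swc. Qed.

Lemma kclosed_swap a b K K' c :
  kclosed a b K' (swap a b K c) <-> kclosed a b K' c.
Proof. by split=> cl x y e; apply: cl; move: e; rewrite tch_swap. Qed.

Lemma swap_symdiff a b K K' c :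
  swap a b K (swap a b K' c) = swap a b (symdiff K K') c.
Proof.
apply: col_ext => x y; rewrite /swap inE.
case: (x \in K); case: (x \in K') => //=.
by case: (c x y) => //= s; rewrite swcK.
Qed.

Lemma swap_none a b c : swap a b set0 c = c.
Proof. by apply: col_ext => x y; rewrite /swap inE. Qed.

Lemma swapK a b K c : swap a b K (swap a b K c) = c.
Proof.
rewrite swap_symdiff -[RHS](swap_none a b); congr swap.
by apply/setP => x; rewrite !inE addbb.
Qed.

Lemma swap_same a K c : swap a a K c = c.
Proof.
apply: col_ext => x y; rewrite /swap; case: ifP => // _.
by case: (c x y) => //= s; rewrite /swc; case: eqP => // ->.
Qed.

Lemma isSome_swap a b K c x y : isSome (swap a b K c x y) = isSome (c x y).
Proof. by rewrite /swap; case: ifP => // _; case: (c x y). Qed.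

Lemma swap_sym a b K c x y : (forall x y, c x y = c y x) -> kclosed a b K c ->
  swap a b K c x y = swap a b K c y x.
Proof.
move=> sc cl; rewrite /swap (sc y x).
case: (boolP (tch a b (c x y))) => [/cl->|/omap_swc_id->]; first by [].
by rewrite !if_same.
Qed.

Lemma pcol_swap a b K c : kclosed a b K c -> pcol c -> pcol (swap a b K c).
Proof.
move=> cl [sc ic pc]; split=> [x y|x|x y z s].
- exact: swap_sym.
- by rewrite /swap ic if_same.
rewrite /swap; case: ifP => _; last exact: pc.
move=> /eqP; rewrite omap_swc_eq => /eqP e1 /eqP; rewrite omap_swc_eq => /eqP.
exact: pc e1.
Qed.

Lemma keq_trans c d e : keq c d -> keq d e -> keq c e.
Proof. by move=> cd; elim=> // e' a b K _; apply: keq_snoc. Qed.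

Lemma keq1 a b K c : kclosed a b K c -> keq c (swap a b K c).
Proof. by move=> cl; apply: keq_snoc cl; apply: keq_refl. Qed.

Lemma keq_sym c d : keq c d -> keq d c.
Proof.
elim=> [|{}d a b K _ dc cl]; first exact: keq_refl.
by apply: keq_trans dc; rewrite -{2}[d](swapK a b K); apply/keq1/kclosed_swap.
Qed.

Lemma keq_pcol c d : keq c d -> pcol c -> pcol d.
Proof. by elim=> // e a b K _ IH cl /IH; apply: pcol_swap. Qed.

Lemma keq_isSome c d x y : keq c d -> isSome (d x y) = isSome (c x y).
Proof. by elim=> // e a b K _ IH cl; rewrite isSome_swap. Qed.

Lemma missesP c x a : reflect (forall y, c x y <> Some a) (misses c x a).
Proof. by apply: (iffP forallP) => h y; [apply/eqP/h|apply/eqP/h]. Qed.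

Lemma missesPn c x a : reflect (exists y, c x y = Some a) (~~ misses c x a).
Proof.
rewrite /misses negb_forall; apply: (iffP existsP) => -[y].
  by rewrite negbK => /eqP; exists y.
by move=> e; exists y; rewrite negbK; apply/eqP.
Qed.

Lemma misses_swap a b K c x s :
  misses (swap a b K c) x s = misses c x (if x \in K then swc a b s else s).
Proof.
apply: eq_forallb => y; rewrite /swap; case: ifP => // _.
by rewrite omap_swc_eq.
Qed.

Lemma misses_tch a b c x y : misses c x a -> misses c x b -> ~~ tch a b (c x y).
Proof.
by move=> /missesP ha /missesP hb; rewrite negb_or; apply/andP; split; apply/eqP.
Qed.

Definition iso a b c x := misses c x a && misses c x b.

(* Changing [K] at vertices incident with no edge coloured [a] or [b] does not
   affect the swap. *)
Lemma kclosed_iso a b K K' c : pcol c ->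
  (forall x, ~~ iso a b c x -> (x \in K) = (x \in K')) ->
  kclosed a b K c -> kclosed a b K' c.
Proof.
move=> [sc _ _] eK cl x y e.
rewrite -!eK; first exact: cl.
  by apply: contraL e => /andP[ha hb]; rewrite sc misses_tch.
by apply: contraL e => /andP[ha hb]; rewrite misses_tch.
Qed.

Lemma swap_iso a b K K' c :
  (forall x, ~~ iso a b c x -> (x \in K) = (x \in K')) ->
  swap a b K' c = swap a b K c.
Proof.
move=> eK; apply: col_ext => x y; rewrite /swap.
case: (boolP (iso a b c x)) => [/andP[ha hb]|/eK->] //.
by rewrite (omap_swc_id (misses_tch y ha hb)) !if_same.
Qed.

(** * Kempe chains and their ends *)

Definition kcomp a b c x : {set T} :=
  [set y | connect (fun u w => tch a b (c u w)) x y].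

Lemma kcomp_self a b c x : x \in kcomp a b c x.
Proof. by rewrite inE connect0. Qed.

Lemma kcomp_closed a b c x : pcol c -> kclosed a b (kcomp a b c x) c.
Proof.
move=> [sc _ _] y z e; rewrite !inE; apply/idP/idP => h; apply: connect_trans h _.
  exact: connect1.
by apply: connect1; rewrite sc.
Qed.

Lemma kcomp_sub a b c x K : kclosed a b K c -> x \in K -> kcomp a b c x \subset K.
Proof.
move=> cl xK; apply/subsetP => y; rewrite inE => /connectP[p + ->] {y}.
elim: p x xK => //= y p IH x xK /andP[e]; apply: IH.
by rewrite -(cl _ _ e).
Qed.

Lemma tch_unique a b c x y z w : pcol c -> y != z ->
  tch a b (c x y) -> tch a b (c x z) -> tch a b (c x w) -> (w == y) || (w == z).
Proof.
move=> [_ _ pc] yz /orP h1 /orP h2 /orP h3; apply/orP.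
case: h1 => /eqP h1; case: h2 => /eqP h2; case: h3 => /eqP h3;
  solve [by case/eqP: yz; apply: pc h1 h2
        | by left; apply/eqP; apply: pc h3 h1
        | by right; apply/eqP; apply: pc h3 h2].
Qed.

(** Exactly one of the two colours is present, so the vertex is an end of an [a]-[b] path. *)
Definition endpt a b c x := misses c x a != misses c x b.

Lemma endpt_unique a b c x y z : pcol c -> endpt a b c x ->
  tch a b (c x y) -> tch a b (c x z) -> y = z.
Proof.
move=> [_ _ pc] ex /orP h1 /orP h2.
have nm w s : c x w = Some s -> misses c x s = false.
  by move=> e; apply/negbTE/missesPn; exists w.
case: h1 => /eqP h1; case: h2 => /eqP h2; try exact: pc h1 h2;
  by move: ex; rewrite /endpt (nm _ _ h1) (nm _ _ h2).
Qed.

Lemma path_inner (r : rel T) x p u : path r x p -> uniq (x :: p) ->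
  u \in p -> u != last x p -> exists u1 u2,
  [/\ u1 \in x :: p, u2 \in x :: p, u1 != u2, r u1 u & r u u2].
Proof.
move=> + + up; case/splitPr: up => p1 [|w p2].
  by rewrite last_cat /= eqxx.
rewrite cat_path -cat_cons cat_uniq => /andP[_ /and3P[h1 h2 _]].
case/and3P=> _ /hasPn h3 _ _; exists (last x p1), w; split=> //.
- by rewrite mem_cat mem_last.
- by rewrite mem_cat !inE eqxx !orbT.
by apply: contraTneq (mem_last x p1) => ->; apply: h3; rewrite !inE eqxx orbT.
Qed.

(** A component has at most two ends. On a simple path from [x] to [y], every inner vertex has both
    its chain edges on the path, while [x] and [y] have only one each; so the path is the whole
    component, and [z] would be an inner vertex of it. *)
Lemma endpt_comp a b c x y z : pcol c ->
  endpt a b c x -> endpt a b c y -> endpt a b c z ->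
  x != y -> x != z -> y != z ->
  y \in kcomp a b c x -> z \notin kcomp a b c x.
Proof.
move=> pc ex ey ez xy xz yz; rewrite inE => /connectP[p0 hp0 ey0].
case: (shortenP hp0) ey0 => {p0 hp0} p hp up _ ey0.
have sc : forall u w, c u w = c w u by case: pc.
have inner u : u \in p -> u != y ->
    ~~ endpt a b c u /\ forall w, tch a b (c u w) -> w \in x :: p.
  move=> ui uy; rewrite ey0 in uy.
  have [u1 [u2 [m1 m2 n12 r1 r2]]] := path_inner hp up ui uy.
  rewrite sc in r1; split.
    by apply: contraNN n12 => eu; apply/eqP; apply: endpt_unique r1 r2.
  by move=> w /(tch_unique pc n12 r1 r2)/orP[]/eqP->.
have cl : kclosed a b [set u in x :: p] c.
  suff sub u w : tch a b (c u w) -> u \in x :: p -> w \in x :: p.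
    by move=> u w e; rewrite !inE; apply/idP/idP; apply: sub; rewrite // sc.
  move=> e; rewrite inE => /orP[/eqP eu|ui].
    case: p hp ey0 {up inner} => [_ ey0|v p /= /andP[r1 _] _].
      by rewrite ey0 eqxx in xy.
    by rewrite eu in e; rewrite (endpt_unique pc ex e r1) !inE eqxx orbT.
  case: (eqVneq u y) => [eu|uy]; last by case: (inner _ ui uy) => _; apply.
  move: e; rewrite eu {eu ui}.
  case/lastP: p hp ey0 {up inner} => [_ ey0|q v]; first by rewrite ey0 eqxx in xy.
  rewrite rcons_path last_rcons => /andP[_ r1] ey0 e; rewrite sc in r1.
  rewrite -ey0 in r1 e *.
  by rewrite (endpt_unique pc ey e r1) -rcons_cons mem_rcons inE mem_last orbT.
apply/negP => /(subsetP (kcomp_sub cl _)); rewrite !inE eqxx => /(_ isT).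
rewrite eq_sym (negPf xz) /= => zp.
by case: (inner _ zp _) => [|/negP[]]; rewrite 1?eq_sym.
Qed.

End Colourings.

(** * Vertices of degree at most two *)

Section EdgeHole.
Variables (T C : finType).
Implicit Types (a b s t : C) (x y z v w : T) (K : {set T}) (c d f g : col T C).

Definition deg c x := #|[set y | isSome (c x y)]|.

Lemma card_misses c x : pcol c -> #|[set a | misses c x a]| + deg c x = #|C|.
Proof.
case=> _ _ pc; rewrite addnC -(cardsC [set a | ~~ misses c x a]).
have -> : ~: [set a | ~~ misses c x a] = [set a | misses c x a].
  by apply/setP => a; rewrite !inE negbK.
congr (_ + _).
have inj : {in [set y | isSome (c x y)] &, injective (c x)}.
  move=> y z; rewrite !inE; case e: (c x y) => [a|//] _ _ e'.
  by apply: pc e _; rewrite -e'.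
rewrite /deg -(card_in_imset inj) -[RHS](card_imset _ (@Some_inj _)).
apply: eq_card => o; apply/imsetP/imsetP => -[y].
  rewrite inE; case e: (c x y) => [a|//] _ ->; exists a => //.
  by rewrite inE; apply/missesPn; exists y.
by rewrite inE => /missesPn[z e] ->; exists z; rewrite // inE e.
Qed.

Lemma keq_deg c d x : keq c d -> deg d x = deg c x.
Proof. by move=> e; apply: eq_card => y; rewrite !inE (keq_isSome _ _ e). Qed.

Definition adde v x s c : col T C := fun y z =>
  if ((y, z) == (v, x)) || ((y, z) == (x, v)) then Some s else c y z.
Definition dele v x c : col T C := fun y z =>
  if ((y, z) == (v, x)) || ((y, z) == (x, v)) then None else c y z.
Definition fits v x c s := misses c v s && misses c x s.

Lemma adde_swap a b K v x s c : kclosed a b K c ->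
  (tch a b (Some s) -> (v \in K) = (x \in K)) ->
  kclosed a b K (adde v x s c) /\
  swap a b K (adde v x s c) =
    adde v x (if v \in K then swc a b s else s) (swap a b K c).
Proof.
move=> cl h; split=> [y z|].
  rewrite /adde; case: ifP => [|_]; last exact: cl.
  move=> /orP[] /eqP e.
    by case: e => -> -> /h.
  by case: e => -> -> /h->.
apply: col_ext => y z; rewrite /swap /adde.
case: (boolP (_ || _)) => [|//]; case/orP=> /eqP[-> _]; first by case: ifP.
case: (boolP (tch a b (Some s))) => [/h->|]; first by case: ifP.
by rewrite tch_Some => /norP[sa sb]; rewrite /= swc_id // !if_same.
Qed.

(** Both ends miss [s] and [t] before the edge is added, so the new edge alone is an [s]-[t]
    component, and swapping it recolours it. *)
Lemma edge_recolour v x s t c : pcol c -> fits v x c s -> fits v x c t ->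
  keq (adde v x s c) (adde v x t c).
Proof.
move=> pc /andP[sv sx] /andP[tv tx]; pose K := [set v; x].
have eK y : ~~ iso s t c y -> (y \in set0) = (y \in K).
  by rewrite !inE => h; apply/esym/negbTE; apply: contraNN h => /orP[]/eqP->;
    apply/andP.
have cl : kclosed s t K c by apply: kclosed_iso pc eK _ => y z; rewrite !inE.
have [|cl' e] := @adde_swap s t K v x s c cl.
  by rewrite !inE !eqxx orbT.
have := keq1 cl'; rewrite e (swap_iso eK) swap_none.
by rewrite !inE eqxx swcL.
Qed.

(* If no common missing colour avoids [a] and [b], then one of the two ends
   meets neither colour, so it can be put on either side of the swap. *)
Lemma edge_link v x a b K c : pcol c -> v != x ->
  1 < #|[set s | misses c x s]| -> #|C| <= #|[set s | misses c v s]|.+1 ->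
  kclosed a b K c -> exists s t, [/\ fits v x c s,
    fits v x (swap a b K c) t & keq (adde v x s c) (adde v x t (swap a b K c))].
Proof.
move=> pc vx mx mv cl.
have vone s t : misses c v s || misses c v t || (s == t).
  apply: contraTT mv => /norP[/norP[hs ht] st]; rewrite -ltnNge.
  rewrite -(cardsC [set r | misses c v r]) -addn2 leq_add2l.
  have <- : #|[set s; t]| = 2 by rewrite cards2 st.
  by apply/subset_leq_card/subsetP => r /set2P[]->; rewrite !inE.
have xtwo t : exists2 s, misses c x s & s != t.
  move: mx; rewrite (cardsD1 t) => h.
  have : 0 < #|[set s | misses c x s] :\ t| by move: h; case: (t \in _) => //= /ltnW.
  by rewrite card_gt0 => /set0Pn[s]; rewrite !inE => /andP[st xs]; exists s.
pose i := iso a b c.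
suff [s hs hst] : exists2 s, fits v x c s & tch a b (Some s) -> i v || i x.
  (* An end that meets neither [a] nor [b] can be put on the side of the other end: this affects
     neither closedness nor the swap. *)
  have [K'' eK h] : exists2 K'' : {set T}, (forall u, ~~ i u -> (u \in K) = (u \in K'')) &
      tch a b (Some s) -> (v \in K'') = (x \in K'').
    case: (boolP (i x)) => ix.
      exists [set u | if u == x then v \in K else u \in K] => [u|_].
        by rewrite inE; case: eqP => // ->; rewrite ix.
      by rewrite !inE (negPf vx) eqxx.
    case: (boolP (i v)) => iv.
      exists [set u | if u == v then x \in K else u \in K] => [u|_].
        by rewrite inE; case: eqP => // ->; rewrite iv.
      by rewrite !inE eq_sym (negPf vx) eqxx.
    by exists K => // /hst; rewrite (negPf ix) (negPf iv).
  have cl' := kclosed_iso pc eK cl.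
  have [cl'' e] := adde_swap cl' h.
  exists s, (if v \in K'' then swc a b s else s); rewrite -(swap_iso eK).
  split=> //; last by rewrite -e; apply: keq1.
  move/andP: hs => [hv hx]; rewrite /fits !misses_swap.
  case: (boolP (tch a b (Some s))) => [/h->|]; first by case: (x \in K''); rewrite ?swcK hv.
  by rewrite tch_Some => /norP[sa sb]; rewrite !(swc_id, if_same) ?hv.
have [[s [fs sa sb]]|none] : (exists s, [/\ fits v x c s, s != a & s != b]) \/
    (forall s, fits v x c s -> tch a b (Some s)).
  case: (pickP [pred s | [&& fits v x c s, s != a & s != b]]) => [s /and3P[]|h].
    by left; exists s.
  right=> s fs; have := h s; rewrite /= fs /= tch_Some.
  by case: (s == a); case: (s == b).
  by exists s; rewrite // tch_Some (negPf sa) (negPf sb).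
have [s fs] : exists s, fits v x c s.
  have [r xr _] := xtwo a; have [s xs sr] := xtwo r.
  have := vone s r; rewrite (negPf sr) orbF => /orP[]h.
    by exists s; apply/andP.
  by exists r; apply/andP.
(* Suppose both ends meet [a] or [b]. The only colour that [v] meets is then [a] or [b], while [x],
   missing two colours, misses some [u] outside {a, b}; this [u] would be a common missing
   colour. *)
exists s => // _; apply/negP => /negP/norP[iv ix].
have [t tv ht] : exists2 t, (t == a) || (t == b) & ~~ misses c v t.
  move: iv; rewrite /i /iso negb_and => /orP[]h; [exists a|exists b] => //.
    by rewrite eqxx.
  by rewrite eqxx orbT.
have [u xu] : exists2 u, misses c x u & ~~ tch a b (Some u).
  move: ix; rewrite /i /iso negb_and => /orP[]h.
    have [r xr rb] := xtwo b; exists r => //; rewrite tch_Some (negPf rb) orbF.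
    by apply: contraNN h => /eqP<-.
  have [r xr rb] := xtwo a; exists r => //; rewrite tch_Some (negPf rb).
  by apply: contraNN h => /eqP<-.
move=> nu; have /negP[] := nu; apply: none; rewrite /fits xu andbT.
have := vone u t; rewrite (negPf ht) orbF; case/orP=> // /eqP e.
by move: nu; rewrite tch_Some e tv.
Qed.

(** Induction on the swap sequence: [edge_link] lifts one swap for some choice of colours on [vx],
    and [edge_recolour] adapts these to the colours already reached. Degrees are those without the
    edge [vx]. *)
Lemma edge_lift v x c d s t : keq c d -> pcol c -> v != x -> (deg c x).+1 < #|C| ->
  deg c v <= 1 -> fits v x c s -> fits v x d t ->
  keq (adde v x s c) (adde v x t d).
Proof.
move=> e pc vx dx dv fs; elim: e t => [|{}d a b K cd IH cl] t ft.
  exact: edge_recolour.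
have pd := keq_pcol cd pc.
have [||s' [t' [fs' ft' h]]] := edge_link pd vx _ _ cl.
- by rewrite -(ltn_add2r (deg d x)) card_misses // (keq_deg _ cd) add1n.
- by rewrite -(card_misses v pd) (keq_deg _ cd) -addn1 leq_add2l.
apply: keq_trans (IH _ fs') (keq_trans h (edge_recolour _ ft' ft)).
exact: pcol_swap.
Qed.

Lemma pcol_dele v x c : pcol c -> pcol (dele v x c).
Proof.
move=> [sc ic pc]; split=> [y z|y|y z w a]; rewrite /dele.
- by rewrite sc orbC ![(z, y) == _]xpair_eqE ![(y, z) == _]xpair_eqE ![(z == _) && _]andbC.
- by case: ifP.
by case: ifP => // _ e; case: ifP => // _; apply: pc e.
Qed.

Lemma dele_adde v x s c : pcol c -> c v x = Some s ->
  adde v x s (dele v x c) = c.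
Proof.
move=> [sc _ _] e; apply: col_ext => y z; rewrite /adde /dele.
by case: (boolP (_ || _)) => [|//]; case/orP=> /eqP[-> ->]; rewrite // sc.
Qed.

Lemma fits_dele v x s c : pcol c -> c v x = Some s -> fits v x (dele v x c) s.
Proof.
move=> [sc _ pc] e; apply/andP; split; apply/missesP => y; rewrite /dele.
  by case: ifP => // h e'; rewrite (pc _ _ _ _ e e') eqxx in h.
rewrite sc in e.
by case: ifP => // h e'; rewrite (pc _ _ _ _ e e') eqxx orbT in h.
Qed.

End EdgeHole.

(** * List configurations around a cubic vertex *)

Section Choices.
Variables (A : eqType).

Fixpoint choices (X : Type) (L : seq (seq X)) : seq (seq X) :=
  if L is l :: L' then [seq a :: s | a <- l, s <- choices L'] else [:: [::]].

Lemma mem_choices (L : seq (seq A)) s :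
  (s \in choices L) = all2 (fun l a => a \in l) L s.
Proof.
elim: L s => [|l L IH] [|a s] //=.
  by apply/negbTE/negP => /allpairsP[] /= ? [].
rewrite -IH; apply/allpairsP/andP => [[[b t] /= [bl ts [-> ->]]] //|[al sL]].
by exists (a, s).
Qed.

Lemma all2_maps (X Y Z : Type) (r : X -> Y -> bool) (f : Z -> X) (g : Z -> Y) s :
  all2 r (map f s) (map g s) = all (fun z => r (f z) (g z)) s.
Proof. by elim: s => //= z s ->. Qed.

Lemma zip_maps (X Y Z : Type) (f : Z -> X) (g : Z -> Y) s :
  zip (map f s) (map g s) = [seq (f z, g z) | z <- s].
Proof. by elim: s => //= z s ->. Qed.

End Choices.

(** The colours are spelt out so that the finite checks below reduce to computation. *)
Definition cs : seq 'I_4 :=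
  [:: @Ordinal 4 0 isT; @Ordinal 4 1 isT; @Ordinal 4 2 isT; @Ordinal 4 3 isT].
Definition twos : seq (seq 'I_4) :=
  [seq [:: a; b] | a : 'I_4 <- cs, b : 'I_4 <- [seq b : 'I_4 <- cs | a < b]].
Definition bools3 := choices [:: [:: true; false]; [:: true; false]; [:: true; false]].
Definition lists3 := choices [:: twos; twos; twos].

(** Systems of distinct representatives: the possible colours of the edges at the deleted vertex. *)
Definition fittings (L : seq (seq 'I_4)) := [seq s <- choices L | uniq s].
Definition even_lists (L : seq (seq 'I_4)) :=
  all (fun a => ~~ odd (count (fun l : seq 'I_4 => a \in l) L)) cs.

(* A swap of a and b in G - v extends to v when no exchanged end of a chain is
   joined to v by a or b (rule1: the edges at v keep their colours), or when
   every neighbour joined to v by a or b is exchanged or misses both (rule2: the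
   edges at v are swapped too).  S tells which lists are exchanged. *)
Definition rule1 (a b : 'I_4) (s : seq 'I_4) (S : seq bool) :=
  all2 (fun e i => i ==> ~~ tch a b (Some e)) s S.
Definition rule2 (a b : 'I_4) (L : seq (seq 'I_4)) (s : seq 'I_4) (S : seq bool) :=
  all2 (fun e q => tch a b (Some e) ==> q.2 || (a \in q.1) && (b \in q.1))
    s (zip L S).
Definition valid (a b : 'I_4) (L : seq (seq 'I_4)) (S : seq bool) :=
  all2 (fun l i => i ==> ((a \in l) != (b \in l))) L S.
Definition swapped_lists (a b : 'I_4) (L : seq (seq 'I_4)) (S : seq bool) :=
  [seq if q.2 then map (swc a b) q.1 else q.1 | q <- zip L S].

Definition linked (a b : 'I_4) L S s := rule1 a b s S || rule2 a b L s S.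

(** Hall's condition for three two-element lists fails only when their union has just two
    colours. *)
Definition constant_lists_unfit := all (fun L => constant L == nilp (fittings L)) lists3.

Definition fittings_linked := all (fun L => all (fun a => all (fun b => all (fun S =>
  if valid a b L S then
    if nilp (fittings L) then true else if nilp (fittings (swapped_lists a b L S)) then true else
    has (linked a b L S) (fittings L)
  else true) bools3) cs) cs) lists3.

Definition even_fittings_linked := all (fun L => if even_lists L then
  all (fun a => all (fun b => all (fun S => if valid a b L S then
    all (linked a b L S) (fittings L) else true) bools3) cs) cs else true) lists3.

Definition no3 := [:: false; false; false].
Definition colour_pairs := [seq (a, b) | a : 'I_4 <- cs, b : 'I_4 <- [seq b : 'I_4 <- cs | a < b]].
(** With [no3] nothing in G - v is exchanged: [rule2] then asks that the [a]-[b] chain through [v]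
    stay within its star, so that swapping it recolours edges at [v] only. *)
Definition grow L X := undup (X ++ flatten [seq
  [seq map (swc q.1 q.2) s | q <- colour_pairs & rule2 q.1 q.2 L s no3] | s <- X]).
Definition odd_fittings_connected := all (fun L => if even_lists L then true else
  if fittings L is s :: l then all (mem (iter 3 (grow L) [:: s])) l else true) lists3.

(** There are six two-element lists, hence 216 triples; this claim and the next three are settled by
    evaluation in the kernel. *)
Lemma constant_lists_unfitP : constant_lists_unfit. Proof. vm_cast_no_check (erefl true). Qed.
Lemma fittings_linkedP : fittings_linked. Proof. vm_cast_no_check (erefl true). Qed.
Lemma even_fittings_linkedP : even_fittings_linked. Proof. vm_cast_no_check (erefl true). Qed.
Lemma odd_fittings_connectedP : odd_fittings_connected. Proof. vm_cast_no_check (erefl true). Qed.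

(** * Deleting a vertex *)

Section VertexRemoval.
Variables (T C : finType) (E : rel T).
Implicit Types (a b s t : C) (x y z v w : T) (K : {set T}) (c d f g : col T C).

Definition gcol c := pcol c /\ forall x y, isSome (c x y) = E x y.
(** The deleted vertex stays in [T] as an isolated vertex, so colourings before and after deletion
    have the same type. *)
Definition vcol v f :=
  pcol f /\ forall x y, isSome (f x y) = [&& E x y, x != v & y != v].
Definition delv v c : col T C :=
  fun x y => if (x == v) || (y == v) then None else c x y.
Definition ext v (sg : T -> option C) f : col T C :=
  fun x y => if x == v then sg y else if y == v then sg x else f x y.

Lemma pcol_delv v c : pcol c -> pcol (delv v c).
Proof.
move=> [sc ic pc]; split=> [x y|x|x y z a]; rewrite /delv.
- by rewrite orbC sc.
- by case: ifP.
by case: ifP => // _ e; case: ifP => // _; apply: pc e.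
Qed.

Lemma vcol_delv v c : gcol c -> vcol v (delv v c).
Proof.
move=> [pc sc]; split; first exact: pcol_delv.
move=> x y; rewrite /delv -negb_or; case: ifP => /= _; first by rewrite andbF.
by rewrite andbT sc.
Qed.

Lemma gcol_swap a b K c : kclosed a b K c -> gcol c -> gcol (swap a b K c).
Proof.
by move=> cl [pc sc]; split; [apply: pcol_swap|move=> x y; rewrite isSome_swap].
Qed.

Lemma vcol_swap v a b K f : kclosed a b K f -> vcol v f -> vcol v (swap a b K f).
Proof.
by move=> cl [pc sc]; split; [apply: pcol_swap|move=> x y; rewrite isSome_swap].
Qed.

Lemma delv_swap v a b K c : delv v (swap a b K c) = swap a b K (delv v c).
Proof.
by apply: col_ext => x y; rewrite /delv /swap; case: (_ || _); rewrite ?if_same.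
Qed.

Lemma delvv v c y : delv v c v y = None.
Proof. by rewrite /delv eqxx. Qed.

Lemma vcol_None v f y : vcol v f -> f v y = None.
Proof.
by move=> [_ /(_ v y)]; rewrite eqxx andbF /=; case: (f v y).
Qed.

Lemma ext_pcol v sg f : pcol f -> (forall y, f v y = None) -> sg v = None ->
  (forall y z a, sg y = Some a -> sg z = Some a -> y = z) ->
  (forall y a, sg y = Some a -> misses f y a) -> pcol (ext v sg f).
Proof.
move=> [sc ic pc] fv sv si sm; split=> [x y|x|x y z a]; rewrite /ext.
- by case: eqP => [->|_]; case: eqP => // ->.
- by case: eqP => // ->.
case: (x =P v) => [_|_]; first exact: si.
case: (y =P v) => [->|_]; case: (z =P v) => [->|_] //.
- by move=> /sm /missesP h /h.
- by move=> e /sm /missesP /(_ _ e).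
exact: pc.
Qed.

Lemma delv_ext v sg f : (forall x y, f x y = f y x) -> (forall y, f v y = None) ->
  delv v (ext v sg f) = f.
Proof.
move=> sf fv; apply: col_ext => x y; rewrite /delv /ext.
by case: (x =P v) => [->|_] //=; case: (y =P v) => [->|_] //; rewrite sf.
Qed.

Lemma ext_gcol v sg f : symmetric E -> irreflexive E -> vcol v f ->
  (forall y, isSome (sg y) = E v y) ->
  (forall y z a, sg y = Some a -> sg z = Some a -> y = z) ->
  (forall y a, sg y = Some a -> misses f y a) ->
  gcol (ext v sg f) /\ delv v (ext v sg f) = f.
Proof.
move=> Es Ei vf sE si sm; have [pf ef] := vf.
have fv y : f v y = None := vcol_None y vf.
split; last by apply: delv_ext => //; case: pf.
split; first by apply: ext_pcol => //; have := sE v; rewrite Ei; case: (sg v).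
move=> x y; rewrite /ext; case: (x =P v) => [->|/eqP xv]; first exact: sE.
by case: (y =P v) => [->|/eqP yv]; rewrite ?sE 1?Es // ef xv yv !andbT.
Qed.

Lemma delv_eq v c d : pcol c -> pcol d -> delv v c = delv v d ->
  (forall y, c v y = d v y) -> c = d.
Proof.
move=> [sc _ _] [sd _ _] e ev; apply: col_ext => x y.
case: (x =P v) => [->|/eqP/negPf xv] //; case: (y =P v) => [->|/eqP/negPf yv].
  by rewrite sc sd.
by have := congr1 (fun h : col T C => h x y) e; rewrite /delv xv yv.
Qed.

Lemma misses_delv v c x a : pcol c -> x != v ->
  misses (delv v c) x a = misses c x a || (c v x == Some a).
Proof.
move=> [sc _ pc] xv; apply/missesP/orP => [h|[/missesP h|/eqP h] y].
- case: (boolP (misses c x a)) => [|/missesPn[y e]]; [by left|right].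
  have := h y; rewrite /delv (negPf xv) /=; case: eqP => [<-|_] // _.
  by rewrite sc e.
- by rewrite /delv; case: ifP.
rewrite /delv (negPf xv) /=; case: eqP => // yv e.
by apply: yv; apply: pc e _; rewrite sc.
Qed.

Lemma kclosed_delv v a b K c : kclosed a b K c -> kclosed a b K (delv v c).
Proof. by move=> cl x y; rewrite /delv; case: ifP => // _ /cl. Qed.

Lemma kclosed_at v a b K c : pcol c -> kclosed a b K (delv v c) ->
  (forall y, tch a b (c v y) -> (v \in K) = (y \in K)) -> kclosed a b K c.
Proof.
move=> [sc _ _] cl h x y.
case: (x =P v) => [->|/eqP/negPf xv]; first exact: h.
case: (y =P v) => [->|/eqP/negPf yv]; first by rewrite sc => /h.
by have := cl x y; rewrite /delv xv yv.
Qed.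

Lemma iso_delv v a b c : iso a b (delv v c) v.
Proof. by apply/andP; split; apply/missesP => y; rewrite delvv. Qed.

(** Dropping from [K] the vertices that meet neither colour in G - v, [v] among them, leaves the
    swap of [delv v c] unchanged. The smaller set is closed in [c], because an exchanged neighbour
    joined to [v] by [a] or [b] would be a chain end. *)
Lemma link1 v a b K c : gcol c -> kclosed a b K (delv v c) ->
  (forall y, y \in K -> endpt a b (delv v c) y -> ~~ tch a b (c v y)) ->
  exists c2, [/\ gcol c2, delv v c2 = swap a b K (delv v c) & keq c c2].
Proof.
move=> gc cl h; have [pc _] := gc; have pf := pcol_delv v pc.
pose K' := [set y in K | ~~ iso a b (delv v c) y].
have eK y : ~~ iso a b (delv v c) y -> (y \in K) = (y \in K').
  by rewrite inE => ->; rewrite andbT.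
have cl' : kclosed a b K' c.
  apply: (kclosed_at pc (kclosed_iso pf eK cl)) => y t.
  rewrite !inE iso_delv andbF; apply/esym/negbTE/negP => /andP[yK ni].
  suff ey : endpt a b (delv v c) y by have := h y yK ey; rewrite t.
  have yv : y != v by apply: contraNneq ni => ->; apply: iso_delv.
  move: ni t; rewrite /endpt /iso !misses_delv // /tch.
  by case: (_ == _); case: (_ == _); case: (misses _ _ _); case: (misses _ _ _).
exists (swap a b K' c); split; [exact: gcol_swap| |exact: keq1].
by rewrite delv_swap (swap_iso eK).
Qed.

(** The opposite choice: these vertices, [v] included, are added to [K], so the edges at [v]
    coloured [a] or [b] are exchanged as well. *)
Lemma link2 v a b K c : gcol c -> kclosed a b K (delv v c) ->
  (forall y, tch a b (c v y) -> (y \in K) || iso a b (delv v c) y) ->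
  exists c2, [/\ gcol c2, delv v c2 = swap a b K (delv v c), keq c c2 &
    forall y, c2 v y = omap (swc a b) (c v y)].
Proof.
move=> gc cl h; have [pc _] := gc; have pf := pcol_delv v pc.
pose K' := [set y | (y \in K) || iso a b (delv v c) y].
have eK y : ~~ iso a b (delv v c) y -> (y \in K) = (y \in K').
  by rewrite inE => /negPf->; rewrite orbF.
have cl' : kclosed a b K' c.
  apply: (kclosed_at pc (kclosed_iso pf eK cl)) => y t.
  by rewrite !inE iso_delv orbT h.
exists (swap a b K' c); split; [exact: gcol_swap| |exact: keq1|].
  by rewrite delv_swap (swap_iso eK).
by move=> y; rewrite /swap inE iso_delv orbT.
Qed.

Lemma vcol_card_misses v f x : symmetric E -> vcol v f -> x != v -> E x v ->
  #|[set a | misses f x a]| + #|[set y | E x y]| = #|C|.+1.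
Proof.
move=> Es [pf ef] xv xE; rewrite -(card_misses x pf) -addnS; congr (_ + _).
rewrite (cardsD1 v) inE xE add1n; congr S.
by apply: eq_card => y; rewrite !inE ef xv /= andbC.
Qed.

End VertexRemoval.

(** * Cubic graphs *)

Section Cubic.
Variables (T : finType) (E : rel T).
Hypotheses (Es : symmetric E) (Ei : irreflexive E).
Hypothesis E3 : forall x y, E x y -> #|[set z | E x z]| = 3.
Notation gcol := (gcol (C := 'I_4) E).
Notation vcol := (vcol (C := 'I_4) E).
Implicit Types (a b s t : 'I_4) (x y z v w : T) (K : {set T}) (c d f g : col T 'I_4).

Definition nb v : seq T := enum (E v).

Lemma mem_nb v y : (y \in nb v) = E v y.
Proof. by rewrite mem_enum. Qed.

Lemma size_nb v y : E v y -> size (nb v) = 3.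
Proof.
by move=> /E3 <-; rewrite -cardE; apply: eq_card => z; rewrite !inE.
Qed.

Lemma nbE v y : E v y -> exists x1 x2 x3, nb v = [:: x1; x2; x3].
Proof.
move/size_nb; case: (nb v) => [|x1 [|x2 [|x3 [|]]]] //= _.
by exists x1, x2, x3.
Qed.

Definition lst f x := [seq a <- cs | misses f x a].
Definition lsts v f := [seq lst f x | x <- nb v].
Definition code v c := [seq odflt (nth (@Ordinal 4 0 isT) cs 0) (c v y) | y <- nb v].

Lemma mem_cs a : a \in cs.
Proof. by case: a => [[|[|[|[|m]]]] //= h]; rewrite !inE. Qed.

Lemma mem_lst f x a : (a \in lst f x) = misses f x a.
Proof. by rewrite mem_filter mem_cs andbT. Qed.

Lemma edge_neq x y : E x y -> x != y.
Proof. by apply: contraTneq => ->; rewrite Ei. Qed.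

Lemma vcol_misses2 v f x : vcol v f -> E v x -> #|[set a | misses f x a]| = 2.
Proof.
move=> vf vx; have xv : E x v by rewrite Es.
have := vcol_card_misses Es vf (edge_neq xv) xv.
by rewrite (E3 xv) card_ord addn3 => -[].
Qed.

Lemma lst_twos f x : #|[set a | misses f x a]| = 2 -> lst f x \in twos.
Proof.
have <- : size (lst f x) = #|[set a | misses f x a]|.
  rewrite -(card_uniqP _); last exact: filter_uniq.
  by apply: eq_card => a; rewrite mem_lst inE.
by rewrite /lst /=; do 4! case: (misses f x _).
Qed.

Lemma lsts_lists3 v y f : E v y -> vcol v f -> lsts v f \in lists3.
Proof.
move=> vy vf; have [x1 [x2 [x3 e]]] := nbE vy.
have h x : x \in nb v -> lst f x \in twos.
  by rewrite mem_nb => /(vcol_misses2 vf)/lst_twos.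
by rewrite /lsts /lists3 mem_choices e /= !h // e !inE eqxx ?orbT.
Qed.

Lemma gcol_at c v y : gcol c -> E v y -> exists a, c v y = Some a.
Proof. by move=> [_ e]; rewrite -e; case: (c v y) => // a; exists a. Qed.

Lemma gcol_fit c v y a : gcol c -> c v y = Some a -> misses (delv v c) y a.
Proof.
move=> [pc ec] e; rewrite misses_delv ?e ?eqxx ?orbT //.
by rewrite eq_sym edge_neq // -ec e.
Qed.

Lemma gcol_inj c v y z a : gcol c -> c v y = Some a -> c v z = Some a -> y = z.
Proof. by case=> -[_ _ pc] _; apply: pc. Qed.

Lemma codeE c v y : gcol c -> E v y ->
  c v y = Some (odflt (nth (@Ordinal 4 0 isT) cs 0) (c v y)).
Proof. by move=> gc /(gcol_at gc)[a ->]. Qed.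

Lemma code_fittings c v : gcol c -> code v c \in fittings (lsts v (delv v c)).
Proof.
move=> gc; rewrite mem_filter; apply/andP; split.
  rewrite map_inj_in_uniq ?enum_uniq // => y z; rewrite !mem_nb => vy vz e.
  by apply: (gcol_inj gc (codeE gc vy)); rewrite e -codeE.
rewrite mem_choices all2_maps; apply/allP => y; rewrite mem_nb => vy.
by rewrite mem_lst; apply: (gcol_fit gc); rewrite -codeE.
Qed.

Lemma code_inj c d v : gcol c -> gcol d -> delv v c = delv v d ->
  code v c = code v d -> c = d.
Proof.
move=> gc gd e ec; have [pc sc] := gc; have [pd sd] := gd.
apply: (delv_eq pc pd e) => y; case: (boolP (E v y)) => [vy|nvy]; last first.
  by have := sc v y; have := sd v y; rewrite (negPf nvy);
    case: (c v y) => //; case: (d v y).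
have /eq_in_map/(_ y) := ec; rewrite mem_nb vy => /(_ isT) ey.
by rewrite (codeE gc vy) (codeE gd vy) ey.
Qed.

Lemma vcol_sym v f : vcol v f -> forall x y, f x y = f y x.
Proof. by case=> -[]. Qed.

Lemma code_ex v f (s : seq 'I_4) : vcol v f -> s \in fittings (lsts v f) ->
  exists c, [/\ gcol c, delv v c = f & code v c = s].
Proof.
move=> vf; rewrite mem_filter mem_choices => /andP[us hs].
have ss : size s = size (nb v).
  by move: hs; rewrite all2E size_map => /andP[/eqP<-].
pose i0 : 'I_4 := nth (@Ordinal 4 0 isT) cs 0.
pose sg y := if E v y then Some (nth i0 s (index y (nb v))) else None.
have hsg y : E v y -> index y (nb v) < size s.
  by move=> vy; rewrite ss index_mem mem_nb.
have [||| gc ec] := @ext_gcol T 'I_4 E v sg f Es Ei vf.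
- by move=> y; rewrite /sg; case: ifP.
- move=> y z a; rewrite /sg; case: ifP => // vy [<-]; case: ifP => // vz [].
  move=> /eqP; rewrite nth_uniq ?hsg // => /eqP e.
  by rewrite -(nth_index v (_ : y \in nb v)) ?mem_nb // -e nth_index ?mem_nb.
- move=> y a; rewrite /sg; case: ifP => // vy [<-].
  move: hs; rewrite all2E => /andP[_ /(all_nthP ([::], i0))].
  move=> /(_ (index y (nb v))); rewrite size_zip size_map ss minnn index_mem.
  rewrite mem_nb => /(_ vy); rewrite nth_zip ?size_map //=.
  by rewrite (nth_map v) ?index_mem ?mem_nb // nth_index ?mem_nb // mem_lst.
exists (ext v sg f); split=> //.
apply: (@eq_from_nth _ i0); rewrite size_map //= => i hi.
rewrite (nth_map v) // /ext eqxx /sg -mem_nb mem_nth //=.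
by rewrite index_uniq // enum_uniq.
Qed.

(** Only chain ends are recorded: any other vertex misses both colours or neither, and the swap does
    not change its set of missing colours. *)
Definition sides a b K v f := [seq (x \in K) && endpt a b f x | x <- nb v].

Lemma sides_bools3 a b K v y f : E v y -> sides a b K v f \in bools3.
Proof.
move=> vy; have [x1 [x2 [x3 e]]] := nbE vy.
have h (i : bool) : i \in [:: true; false] by case: i.
by rewrite /sides e /bools3 mem_choices /= !h.
Qed.

Lemma sides_valid a b K v f : valid a b (lsts v f) (sides a b K v f).
Proof.
rewrite /valid all2_maps; apply/allP => x _.
by rewrite !mem_lst; apply/implyP => /andP[].
Qed.

Lemma rule2_link v a b K c : gcol c -> kclosed a b K (delv v c) ->
  rule2 a b (lsts v (delv v c)) (code v c) (sides a b K v (delv v c)) ->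
  exists c2, [/\ gcol c2, delv v c2 = swap a b K (delv v c), keq c c2 &
    code v c2 = map (swc a b) (code v c)].
Proof.
move=> gc cl; rewrite /rule2 zip_maps all2_maps => /allP h.
have [y t|c2 [g2 e2 k2 s2]] := link2 gc cl.
  have vy : E v y by case: gc => _ <-; case: (c v y) t.
  move: (h y); rewrite mem_nb vy => /(_ isT)/implyP; rewrite -codeE // t => /(_ isT).
  by rewrite /= !mem_lst -/(iso a b _ _) => /orP[/andP[->//]|->]; rewrite orbT.
exists c2; split=> //; rewrite -map_comp; apply/eq_in_map => y.
by rewrite mem_nb => vy /=; rewrite s2 (codeE gc vy).
Qed.

Lemma linked_link v a b K c : gcol c -> kclosed a b K (delv v c) ->
  linked a b (lsts v (delv v c)) (sides a b K v (delv v c)) (code v c) ->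
  exists c2, [/\ gcol c2, delv v c2 = swap a b K (delv v c) & keq c c2].
Proof.
move=> gc cl /orP[|/(rule2_link gc cl)[c2 [? ? ? _]]]; last by exists c2.
rewrite /rule1 all2_maps => /allP h; apply: link1 => // y yK ey.
case: (boolP (E v y)) => [vy|nvy].
  have := h y; rewrite mem_nb vy => /(_ isT)/implyP; rewrite -codeE //.
  by apply; rewrite yK.
by case: gc => _ /(_ v y); rewrite (negPf nvy); case: (c v y).
Qed.

Lemma not_constant_ext v y f : E v y -> vcol v f -> ~~ constant (lsts v f) ->
  exists2 c, gcol c & delv v c = f.
Proof.
move=> vy vf nc; have := allP constant_lists_unfitP _ (lsts_lists3 vy vf).
rewrite (negPf nc) => /eqP; case e: (fittings _) => [|s l] // _.
have [|c [gc ec _]] := @code_ex v f s vf; first by rewrite e inE eqxx.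
by exists c.
Qed.

Lemma ext_not_constant v y c : E v y -> gcol c -> ~~ constant (lsts v (delv v c)).
Proof.
move=> vy gc; have := allP constant_lists_unfitP _ (lsts_lists3 vy (vcol_delv v gc)) => /eqP->.
by have := code_fittings v gc; case: (fittings _).
Qed.

(** Vacuously true when [f] has no extension, as happens for three equal lists. *)
Definition rigid v f := forall c d, gcol c -> gcol d ->
  delv v c = f -> delv v d = f -> keq c d.

Lemma sides0 a b v y f : E v y -> sides a b set0 v f = no3.
Proof.
by move=> vy; have [x1 [x2 [x3 e]]] := nbE vy; rewrite /sides e /= !inE.
Qed.

Lemma iter_grow v y c n (t : seq 'I_4) : E v y -> gcol c ->
  t \in iter n (grow (lsts v (delv v c))) [:: code v c] ->
  exists d, [/\ gcol d, delv v d = delv v c, code v d = t & keq c d].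
Proof.
move=> vy gc; elim: n t => [|n IH] t /=.
  by rewrite inE => /eqP->; exists c; split=> //; apply: keq_refl.
rewrite mem_undup mem_cat => /orP[/IH //|/flattenP[_ /mapP[s /IH[d [gd ed <- kd]] ->]]].
case/mapP=> -[a b]; rewrite mem_filter => /andP[/= r _] ->.
have [||d2 [g2 e2 k2 s2]] := rule2_link (K := set0) (a := a) (b := b) (v := v) gd _ _.
- by move=> x z; rewrite !inE.
- by rewrite (sides0 a b _ vy) ed.
exists d2; split=> //; first by rewrite e2 swap_none.
exact: keq_trans kd k2.
Qed.

(** By the finite check every extension arises from the first one by swaps within the star of [v],
    and an extension is determined by its code. *)
Lemma odd_rigid v y f : E v y -> vcol v f -> ~~ even_lists (lsts v f) -> rigid v f.
Proof.
move=> vy vf odd; have := allP odd_fittings_connectedP _ (lsts_lists3 vy vf).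
rewrite (negPf odd); case e: (fittings _) => [|s l] h.
  by move=> c d gc _ ec; have := code_fittings v gc; rewrite ec e.
have [|c0 [g0 e0 s0]] := @code_ex v f s vf; first by rewrite e inE eqxx.
suff H c : gcol c -> delv v c = f -> keq c0 c.
  move=> c d gc gd ec ed.
  by apply: keq_trans (H d gd ed); apply: keq_sym; apply: H.
move=> gc ec; have := code_fittings v gc; rewrite ec e inE => /orP[/eqP es|hl].
  by rewrite (@code_inj c c0 v) ?ec ?e0 ?s0 //; apply: keq_refl.
have hm : code v c \in iter 3 (grow (lsts v f)) [:: s] := allP h _ hl.
rewrite -e0 -s0 in hm; have [d [gd ed sd kd]] := iter_grow vy g0 hm.
by rewrite (@code_inj c d v) ?ec ?ed ?sd ?e0.
Qed.

Hypothesis IH : forall v y f g, E v y -> vcol v f -> vcol v g -> keq f g.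

(* An even list configuration has two extensions, in no obvious way related
   inside the star; both survive any swap, and hence meet once the swaps reach
   a configuration that is not even. *)
Lemma odd_all_rigid v y f g : E v y -> vcol v f -> ~~ even_lists (lsts v f) ->
  vcol v g -> rigid v g.
Proof.
move=> vy vf odd vg; have kfg := IH vy vf vg; elim: kfg vg => [|{}g a b K kg IHg cl] vg'.
  exact: (odd_rigid vy vf odd).
have cl' : kclosed a b K (swap a b K g) by apply/kclosed_swap.
have vg : vcol v g by rewrite -(swapK a b K g); apply: vcol_swap.
case: (boolP (even_lists (lsts v (swap a b K g)))) => [ev|]; last exact: (odd_rigid vy vg').
(* Every extension of the swapped colouring can be carried back along the swap to [g], where
   rigidity is known by induction. *)
have lk c : gcol c -> delv v c = swap a b K g ->
    exists c2, [/\ gcol c2, delv v c2 = g & keq c c2].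
  move=> gc ec; have := allP even_fittings_linkedP _ (lsts_lists3 vy vg'); rewrite ev.
  move=> /allP/(_ a (mem_cs a))/allP/(_ b (mem_cs b))/allP.
  move=> /(_ _ (sides_bools3 a b K (swap a b K g) vy)); rewrite sides_valid.
  move=> /allP/(_ (code v c)); rewrite -ec => /(_ (code_fittings v gc)) l.
  have [|c2 [g2 e2 k2]] := linked_link gc _ l; first by rewrite ec.
  by exists c2; split=> //; rewrite e2 ec swapK.
move=> c d gc gd ec ed; have [c2 [g2 e2 k2]] := lk _ gc ec.
have [d2 [h2 f2 l2]] := lk _ gd ed.
exact: keq_trans k2 (keq_trans (IHg vg _ _ g2 h2 e2 f2) (keq_sym l2)).
Qed.

(** The finite check provides one extension of [f] that survives the swap; rigidity on both sides
    joins it to [c] and its image to [d]. *)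
Lemma swap_ext_keq v y f a b K c d : E v y -> vcol v f -> kclosed a b K f ->
  rigid v f -> rigid v (swap a b K f) -> gcol c -> gcol d ->
  delv v c = f -> delv v d = swap a b K f -> keq c d.
Proof.
move=> vy vf cl rf rf' gc gd ec ed.
have := allP fittings_linkedP _ (lsts_lists3 vy vf).
move=> /allP/(_ a (mem_cs a))/allP/(_ b (mem_cs b))/allP.
move=> /(_ _ (sides_bools3 a b K f vy)); rewrite sides_valid.
have -> : nilp (fittings (lsts v f)) = false.
  by have := code_fittings v gc; rewrite ec; case: (fittings _).
have -> : nilp (fittings (swapped_lists a b (lsts v f) (sides a b K v f))) = false.
  apply/negbTE; suff : code v d \in fittings (swapped_lists a b (lsts v f) (sides a b K v f)).
    by case: (fittings _).
  have := code_fittings v gd; rewrite ed !mem_filter => /andP[-> /=].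
  rewrite !mem_choices /swapped_lists zip_maps -map_comp !all2_maps.
  apply: sub_all => x /=; rewrite mem_lst misses_swap; case: ifP => [xK|_].
    (* An exchanged neighbour that is not a chain end misses both colours or neither, so its list is
       invariant under the exchange. *)
    case: ifP => [_|/negbT/negPn/eqP e]; last first.
      rewrite mem_lst /swc; case: eqP => [->|_]; first by rewrite e.
      by case: eqP => [->|//]; rewrite e.
    rewrite -{2}[odflt _ _](swcK a b) => h; apply: map_f; by rewrite mem_lst.
  by rewrite mem_lst.
case/hasP=> s sf l1.
have [c0 [g0 e0 s0']] := code_ex vf sf.
have [||c2 [g2 e2 k2]] := @linked_link v a b K c0 g0; rewrite ?e0 ?s0' //.
apply: keq_trans (rf _ _ gc g0 ec e0) (keq_trans k2 _).
by apply: rf' => //; rewrite e2 e0.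
Qed.

(** * Parity of the three lists around a vertex *)

Definition nb3 v x y z := uniq [:: x; y; z] && all (E v) [:: x; y; z].

Lemma nb3_mem v x y z w : nb3 v x y z -> E v w = (w \in [:: x; y; z]).
Proof.
case/andP=> u /allP a; have vx : E v x by apply: a; rewrite inE eqxx.
have [||_ e] := @uniq_min_size _ [:: x; y; z] (nb v) u.
- by move=> t /a; rewrite mem_nb.
- by rewrite (size_nb vx).
by rewrite e mem_nb.
Qed.

Lemma nb3_rot v x y z : nb3 v x y z -> nb3 v y z x.
Proof.
rewrite /nb3 -(rot_uniq 1) => /andP[-> /and4P[h1 h2 h3 _]].
by rewrite /= h1 h2 h3.
Qed.

Lemma nb3_ex v x : E v x -> exists y z, nb3 v x y z.
Proof.
move=> vx; have [x1 [x2 [x3 e]]] := nbE vx.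
have n3 : nb3 v x1 x2 x3.
  apply/andP; split; first by rewrite -e enum_uniq.
  by rewrite -e; apply/allP => y; rewrite mem_nb.
have := vx; rewrite -mem_nb e !inE => /or3P[]/eqP->.
- by exists x2, x3.
- by exists x3, x1; apply: nb3_rot.
by exists x1, x2; apply/nb3_rot/nb3_rot.
Qed.

Lemma nb3_swap v x y z : nb3 v x y z -> nb3 v x z y.
Proof.
by rewrite /nb3 /= !inE !negb_or [z == y]eq_sym !andbT =>
  /andP[/andP[/andP[-> ->] ->] /and3P[-> -> ->]].
Qed.

Lemma odd_count v x y z f a : nb3 v x y z ->
  misses f x a (+) misses f y a (+) misses f z a -> ~~ even_lists (lsts v f).
Proof.
move=> n3 o; apply/negP => /allP/(_ a (mem_cs a)).
rewrite count_map (eq_count (_ : _ =1 misses f ^~ a)); last first.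
  by move=> t /=; rewrite mem_lst.
have /seq.permP-> : perm_eq (nb v) [:: x; y; z].
  apply: uniq_perm; [exact: enum_uniq|by case/andP: n3|move=> t].
  by rewrite mem_nb (nb3_mem _ n3).
by move: o => /=; rewrite !oddD !oddb addbF addbA => ->.
Qed.

Lemma even_count v x y z f a : nb3 v x y z -> even_lists (lsts v f) ->
  misses f x a (+) misses f y a (+) misses f z a = false.
Proof. by move=> n3 ev; apply: contraTF ev; apply: odd_count n3. Qed.

Lemma vcol_missesP v x f a b s : vcol v f -> E v x -> misses f x a -> misses f x b ->
  a != b -> misses f x s = (s == a) || (s == b).
Proof.
move=> vf vx ha hb ab.
have e : [set a; b] = [set s | misses f x s].
  apply/eqP; rewrite eqEcard (vcol_misses2 vf vx) cards2 ab andbT.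
  by apply/subsetP => t /set2P[]->; rewrite inE.
by have := congr1 (fun A : {set 'I_4} => s \in A) e; rewrite !inE => ->.
Qed.

Lemma kclosed_sub a b K c : pcol c ->
  (forall x y, tch a b (c x y) -> x \in K -> y \in K) -> kclosed a b K c.
Proof.
move=> [sc _ _] h x y t; apply/idP/idP; first exact: h.
by apply: h; rewrite sc.
Qed.

(* If deleting [u] gives an even configuration, then three vertices adjacent
   to [u] miss, up to one recolouring, a common colour; otherwise the
   configuration at one of them is not even. *)
Lemma odd_exists c u x : gcol c -> E u x ->
  exists v y f, [/\ E v y, vcol v f & ~~ even_lists (lsts v f)].
Proof.
move=> gc ux; have [pc ec] := gc; have [sc _ uc] := pc.
have vf := vcol_delv u gc; have [pf _] := vf.
case: (boolP (even_lists (lsts u (delv u c)))) => [ev|od]; last first.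
  by exists u, x, (delv u c).
have [r cr] := gcol_at gc ux; have xr := gcol_fit gc cr.
(* Evenness for [r], the colour of [ux]: exactly one of the other two neighbours of [u] misses
   [r]. *)
have [p [q [n3 npr qr]]] : exists p q,
    [/\ nb3 u x p q, ~~ misses (delv u c) p r & misses (delv u c) q r].
  have [p [q n3]] := nb3_ex ux; have := even_count r n3 ev; rewrite xr.
  case e1: (misses _ p r); case e2: (misses _ q r) => // _.
    by exists q, p; rewrite e1 e2; split=> //; apply: nb3_swap.
  by exists p, q; rewrite e1 e2.
have up : E u p by rewrite (nb3_mem _ n3) !inE eqxx orbT.
have [t ct] := gcol_at gc up; have pt := gcol_fit gc ct.
have tr : t != r by apply: contraNneq npr => <-.
have [w fw] := missesPn _ _ _ npr.
have wu : w != u.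
  by apply/eqP => e; move: fw; rewrite e /delv eqxx orbT.
have pu : p != u by rewrite eq_sym edge_neq.
have cw : c p w = Some r by move: fw; rewrite /delv (negPf wu) (negPf pu).
have wr : ~~ misses (delv u c) w r.
  by apply/missesPn; exists p; rewrite (vcol_sym vf).
case: (boolP (misses (delv u c) w t)) => wt.
  (* Both [p] and [w] miss [t], so the edge [pw] is an entire [r]-[t] chain; swapping it makes all
     three neighbours of [u] miss [r]. *)
  pose K := [set p; w].
  have cl : kclosed r t K (delv u c).
    apply: kclosed_sub => // y z; rewrite !inE => h /orP[]/eqP e; move: h; rewrite e.
      case/orP=> /eqP h; last by case: (missesP _ _ _ pt _ h).
      by case: pf => _ _ /(_ _ _ _ _ h fw)->; rewrite eqxx orbT.
    case/orP=> /eqP h; last by case: (missesP _ _ _ wt _ h).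
    by rewrite (vcol_sym vf) in fw; case: pf => _ _ /(_ _ _ _ _ h fw)->; rewrite eqxx.
  exists u, x, (swap r t K (delv u c)); split=> //; first exact: vcol_swap.
  apply: (odd_count (a := r) n3); rewrite !misses_swap !inE eqxx /=.
  have nK y : misses (delv u c) y r -> (y == p) || (y == w) = false.
    by move=> h; apply/negbTE; apply/norP; split; apply: contraTneq h => ->.
  by rewrite !nK // swcL xr qr pt.
have pw : E p w by rewrite -ec cw.
have puE : E p u by rewrite Es.
have [s n3'] : exists s : T, nb3 p u w s.
  have [y [z n3']] := nb3_ex puE; have := pw; rewrite (nb3_mem _ n3') !inE (negPf wu) /=.
  by case/orP=> /eqP e; [exists z; rewrite e|exists y; rewrite e; apply: nb3_swap].
(* Otherwise delete [p]: its neighbour [u] then misses [t] but not [r], and [w] misses [r] but not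
   [t]. If the third neighbour [s] does not miss [t], then [t] is missed once; if it does, its other
   missing colour is not [r], and [r] is missed once. *)
exists p, u, (delv p c); split=> //; first exact: vcol_delv.
have vh := vcol_delv p gc.
have up' : u != p by rewrite eq_sym.
have wp : w != p by rewrite eq_sym edge_neq.
have cpu : c p u = Some t by rewrite sc.
have ps : E p s by rewrite (nb3_mem _ n3') !inE eqxx !orbT.
have sp : s != p by rewrite eq_sym edge_neq.
have hut : misses (delv p c) u t by rewrite misses_delv // cpu eqxx orbT.
have hwt : misses (delv p c) w t = false.
  rewrite misses_delv // cw; apply/negbTE; rewrite negb_or; apply/andP; split.
    by move: wt; rewrite misses_delv // => /norP[].
  by apply: contra_neq tr => -[->].
have hwr : misses (delv p c) w r by rewrite misses_delv // cw eqxx orbT.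
have hur : misses (delv p c) u r = false.
  rewrite misses_delv // cpu; apply/negbTE; rewrite negb_or; apply/andP; split.
    by apply/missesPn; exists x.
  by apply: contra_neq tr => -[->].
case st: (misses (delv p c) s t); last first.
  by apply: (odd_count (a := t) n3'); rewrite hut hwt st.
apply: (odd_count (a := r) n3'); rewrite hur hwr /=.
have [g cg] := gcol_at gc ps; have sg := gcol_fit gc cg.
have gt : g != t.
  apply: contraTneq n3' => e; move: cg; rewrite e => /(uc _ _ _ _ cpu) <-.
  by rewrite /nb3 /= !inE eqxx orbT.
rewrite (vcol_missesP r vh ps sg st gt) [r == t]eq_sym (negPf tr) orbF.
apply/negP => /eqP e; have := cg; rewrite -e => /(uc _ _ _ _ cw) ws.
by move: n3'; rewrite -ws /nb3 /= !inE eqxx /= andbF.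
Qed.

(** * Coinciding lists *)

Definition equal_lists v f a b := forall x, E v x ->
  forall s, misses f x s = (s == a) || (s == b).
(** The set [K] may be empty, so extensions of [f] itself count as well; three equal lists admit
    none, and genuine swaps take over. *)
Definition near v f c := gcol c /\
  exists a b K, kclosed a b K f /\ delv v c = swap a b K f.
(* If all lists of f equal {a1, a2}, these are the swaps that keep them so. *)
Definition parallel a1 a2 b1 b2 f g := exists K K',
  [/\ kclosed a1 a2 K f, kclosed b1 b2 K' f & g = swap b1 b2 K' (swap a1 a2 K f)].

Lemma swc_pred (P : pred 'I_4) a b s : P a = P b -> P (swc a b s) = P s.
Proof. by move=> e; rewrite /swc; case: eqP => [->|_] //; case: eqP => [->|]. Qed.

Lemma four_mem (l : seq 'I_4) s : uniq l -> size l = 4 -> s \in l.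
Proof.
move=> u sz; have [||_ ->] := @uniq_min_size _ l cs u; rewrite ?sz ?mem_cs //.
by move=> t _; apply: mem_cs.
Qed.

Lemma four_compl a1 a2 b1 b2 s : uniq [:: a1; a2; b1; b2] ->
  (s == b1) || (s == b2) = ~~ ((s == a1) || (s == a2)).
Proof.
move=> u; have := four_mem s u erefl; move: u.
rewrite -[[:: a1; a2; b1; b2]]/([:: a1; a2] ++ [:: b1; b2]) cat_uniq mem_cat.
case/and3P=> _ /hasPn h _; have := h s; rewrite !inE.
by case: ((s == b1) || _); [move=> /(_ isT)->|rewrite orbF => _ ->].
Qed.

Lemma four_ex a1 a2 : a1 != a2 -> exists b1 b2, uniq [:: a1; a2; b1; b2].
Proof.
move=> a12; have : #|~: [set a1; a2]| = 2.
  by rewrite cardsCs setCK cards2 a12 card_ord.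
move/eqP/cards2P=> [b1 [b2 [b12 e]]]; exists b1, b2.
have [h1 h2] : b1 \in ~: [set a1; a2] /\ b2 \in ~: [set a1; a2].
  by rewrite e !inE !eqxx orbT.
move: h1 h2; rewrite !inE !negb_or /= !inE !negb_or a12 b12 !andbT /=.
by rewrite ![_ == b1]eq_sym ![_ == b2]eq_sym => /andP[-> ->] /andP[-> ->].
Qed.

Lemma four_rot a1 a2 b1 b2 : uniq [:: a1; a2; b1; b2] -> uniq [:: b1; b2; a1; a2].
Proof. by rewrite -(rot_uniq 2). Qed.

Lemma lsts_eq v f : constant (lsts v f) ->
  forall x y s, E v x -> E v y -> misses f x s = misses f y s.
Proof.
move=> k x y s vx vy; rewrite -!mem_lst; congr (s \in _); move: k.
have hy : lst f y \in lsts v f by apply/map_f; rewrite mem_nb.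
have hx : lst f x \in lsts v f by apply/map_f; rewrite mem_nb.
case: (lsts v f) hy hx => // l L; rewrite !inE => hy hx /allP h.
have g m : (m == l) || (m \in L) -> m = l by case/orP=> [/eqP//|/h/eqP].
by rewrite (g _ hx) (g _ hy).
Qed.

Lemma constant_lsts v x f : E v x -> vcol v f -> constant (lsts v f) ->
  exists a b, a != b /\ equal_lists v f a b.
Proof.
move=> vx vf k; have /eqP/cards2P[a [b [ab e]]] := vcol_misses2 vf vx.
exists a, b; split=> // y vy s.
rewrite (lsts_eq k s vy vx).
by have := congr1 (fun A : {set 'I_4} => s \in A) e; rewrite !inE.
Qed.

Lemma lsts_constant v f : (forall x y s, E v x -> E v y -> misses f x s = misses f y s) ->
  constant (lsts v f).
Proof.
move=> h; rewrite /constant.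
have H l m : l \in lsts v f -> m \in lsts v f -> l == m.
  case/mapP=> x; rewrite mem_nb => vx -> /mapP[y]; rewrite mem_nb => vy ->.
  by apply/eqP/eq_filter => s; apply: h.
case: (lsts v f) H => // l L H; apply/allP => m mL.
by apply: H; rewrite inE ?eqxx ?mL ?orbT.
Qed.

Lemma equal_lists_constant v f a b : equal_lists v f a b -> constant (lsts v f).
Proof. by move=> t; apply: lsts_constant => x y s vx vy; rewrite !t. Qed.

Lemma equal_lists_odd v x f a b : E v x -> a != b -> equal_lists v f a b ->
  ~~ even_lists (lsts v f).
Proof.
move=> vx ab t; have [y [z n3]] := nb3_ex vx; have n := nb3_mem _ n3.
by apply: (odd_count (a := a) n3); rewrite !t ?n ?inE ?eqxx ?orbT.
Qed.

Lemma equal_lists_swap v f a1 a2 a b K :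
  ((a == a1) || (a == a2)) = ((b == a1) || (b == a2)) ->
  equal_lists v f a1 a2 -> equal_lists v (swap a b K f) a1 a2.
Proof.
move=> e t x vx s; rewrite misses_swap t //; case: ifP => // _.
exact: (@swc_pred (fun s => (s == a1) || (s == a2))).
Qed.

Lemma near_ext v f c : gcol c -> delv v c = f -> near v f c.
Proof.
move=> gc <-; split=> //; pose a := nth (@Ordinal 4 0 isT) cs 0.
by exists a, a, set0; split; [move=> x y; rewrite !inE|rewrite swap_none].
Qed.

(** * Moving the hole to a neighbouring vertex *)

Definition sg2 (j k : T) (p q : 'I_4) y :=
  if y == j then Some p else if y == k then Some q else None.
(* The colouring f of G - v, seen from G - x: the edges vj and vk get the
   colours p and q. *)
Definition hole v x j k p q f := delv x (ext v (sg2 j k p q) f).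

Lemma sg2_swap j k p q : j != k -> sg2 j k p q =1 sg2 k j q p.
Proof.
by move=> jk y; rewrite /sg2; case: (y =P j) => // ->; rewrite (negPf jk).
Qed.

Lemma hole_swap v x j k p q f : j != k -> hole v x j k p q f = hole v x k j q p f.
Proof.
move=> jk; apply: col_ext => y z; rewrite /hole /delv; case: ifP => // _.
by rewrite /ext !(sg2_swap _ _ jk).
Qed.

Section Hole.
Variables (v x j k : T) (p q : 'I_4) (f : col T 'I_4).
Hypotheses (vf : vcol v f) (n3 : nb3 v x j k) (pq : p != q).
Hypotheses (mp : misses f j p) (mq : misses f k q).

Lemma nb3_neq : [/\ j != k, x != j, x != k & [/\ x != v, j != v & k != v]].
Proof.
have n := nb3_mem _ n3; have h y : E v y -> y != v by rewrite Es; apply: edge_neq.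
rewrite !h ?n ?inE ?eqxx ?orbT //.
by move: n3; rewrite /nb3 /= !inE negb_or !andbT => /andP[/andP[/andP[-> ->] ->]].
Qed.

Lemma ext_hole_pcol : pcol (ext v (sg2 j k p q) f).
Proof.
have [jk _ _ [_ jv kv]] := nb3_neq; have [pf _] := vf.
apply: ext_pcol => //.
- by move=> y; apply: vcol_None vf.
- by rewrite /sg2 eq_sym (negPf jv) eq_sym (negPf kv).
- move=> y z s; rewrite /sg2; case: (y =P j) => [->|_].
    move=> [<-]; case: (z =P j) => [->|_] //; case: eqP => // _ [/eqP].
    by rewrite eq_sym (negPf pq).
  case: (y =P k) => [->|//] [<-]; case: (z =P j) => [_ [/eqP]|_].
    by rewrite (negPf pq).
  by case: eqP => // ->.
by move=> y s; rewrite /sg2; case: eqP => [-> [<-]|_] //; case: eqP => [-> [<-]|].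
Qed.

Lemma hole_vcol : vcol x (hole v x j k p q f).
Proof.
have [jk xj xk [xv jv kv]] := nb3_neq.
split; first exact/pcol_delv/ext_hole_pcol.
have hs y : y != x -> isSome (sg2 j k p q y) = E v y.
  by move=> yx; rewrite (nb3_mem _ n3) !inE (negPf yx) /sg2; case: eqP => //; case: eqP.
have [_ ef] := vf => y z; rewrite /hole /delv -negb_or; case: ifP => [_|].
  by rewrite andbF.
move=> /norP[yx zx]; rewrite andbT /ext; case: (y =P v) => [->|/eqP yv]; first exact: hs.
case: (z =P v) => [->|/eqP zv]; first by rewrite hs // Es.
by rewrite ef yv zv !andbT.
Qed.

Lemma hole_v y : y != x -> hole v x j k p q f v y = sg2 j k p q y.
Proof.
have [_ _ _ [xv _ _]] := nb3_neq.
by move=> yx; rewrite /hole /delv /ext eq_sym (negPf xv) (negPf yx) eqxx.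
Qed.

Lemma hole_misses_v s : misses (hole v x j k p q f) v s = (s != p) && (s != q).
Proof.
have [jk xj xk _] := nb3_neq; apply/missesP/andP => [h|[sp sq] y].
  split; apply/eqP => e.
    by apply: (h j); rewrite hole_v 1?eq_sym // /sg2 eqxx e.
  by apply: (h k); rewrite hole_v 1?eq_sym // /sg2 eq_sym (negPf jk) eqxx e.
case: (eqVneq y x) => [->|yx]; first by rewrite /hole /delv eqxx orbT.
rewrite hole_v // /sg2; case: eqP => _; first by case=> e; rewrite e eqxx in sp.
by case: eqP => // _ [e]; rewrite e eqxx in sq.
Qed.

Lemma hole_misses y s : y != v -> y != x -> misses (hole v x j k p q f) y s =
  misses f y s && (sg2 j k p q y != Some s) || (f x y == Some s).
Proof.
move=> yv yx; have [_ _ _ [xv _ _]] := nb3_neq.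
rewrite /hole misses_delv //; last exact: ext_hole_pcol.
rewrite /ext (negPf xv) (negPf yv); congr (_ || _).
apply/missesP/andP => [h|[/missesP h /eqP e] z].
  split; last by apply/eqP => e; apply: (h v); rewrite (negPf yv) eqxx.
  apply/missesP => z e; apply: (h z); rewrite (negPf yv).
  by case: eqP => // zv; move: e; rewrite zv (vcol_sym vf) (vcol_None _ vf).
by rewrite (negPf yv); case: eqP.
Qed.

Lemma delv_hole : delv v (hole v x j k p q f) = delv x f.
Proof.
apply: col_ext => y z; rewrite /hole /delv /ext.
case: (y =P v) => [->|_] /=; first by rewrite (vcol_None _ vf) if_same.
by case: (z =P v) => [->|_] //; rewrite (vcol_sym vf) (vcol_None _ vf) if_same.
Qed.

(** The only new edges join [v], outside [K], to [j] and [k]; those coloured [a] or [b] end outside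
    [K] too, by hypothesis. Removing [x] is harmless, as it is isolated. *)
Lemma kclosed_hole a b K : kclosed a b K f -> v \notin K ->
  (forall y, tch a b (sg2 j k p q y) -> y \notin K) ->
  kclosed a b (K :\ x) (hole v x j k p q f).
Proof.
move=> cl vK h; have pg : pcol (ext v (sg2 j k p q) f) := ext_hole_pcol.
have pf : pcol f by case: vf.
have ef : delv v (ext v (sg2 j k p q) f) = f.
  by apply: delv_ext => [|y]; [case: pf|apply: vcol_None vf].
apply: (kclosed_iso (pcol_delv x pg) (K := K)).
  by move=> y ny; rewrite !inE; case: eqP => // e; rewrite e iso_delv in ny.
apply: kclosed_delv; apply: (kclosed_at (v := v) pg); first by rewrite ef.
by move=> y; rewrite /ext eqxx => /h/negPf->; apply/negbTE.
Qed.

End Hole.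

(** The swap turns the list of [x] into {b, a'} while [j] keeps {a, a'}, so [vx], [vj], [vk] can
    receive [b], [a], [a']. Seen from [x], this extension is the same swap applied to the hole
    colouring. *)
Lemma near_hole_in v x j k a a' b K f c : vcol v f -> nb3 v x j k ->
  equal_lists v f a a' -> a != a' -> ~~ ((b == a) || (b == a')) ->
  (forall g, vcol v g -> rigid v g) ->
  kclosed a b K f -> x \in K -> j \notin K ->
  gcol c -> delv v c = swap a b K f ->
  exists2 d, keq c d & near x (hole v x j k a a' f) d.
Proof.
move=> vf n3 t aa' /norP[ba ba'] R cl xK jK gc ec.
have n := nb3_mem _ n3; have [jk xj xk [xv jv kv]] := nb3_neq n3.
have [vx vj vk] : [/\ E v x, E v j & E v k] by rewrite !n !inE !eqxx !orbT.
have vf' : vcol v (swap a b K f) := vcol_swap cl vf.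
have sa' : swc a b a' = a' by rewrite swc_id // eq_sym.
pose sg y := if y == x then Some b else sg2 j k a a' y.
have [||| gd ed] := @ext_gcol T 'I_4 E v sg _ Es Ei vf'.
- by move=> y; rewrite n !inE /sg /sg2; case: eqP => //; case: eqP => //; case: eqP.
- move=> y z s; rewrite /sg /sg2; case: (y =P x) => [->|_]; case: (z =P x) => [->|_] //.
  + move=> [<-]; case: eqP => _; first by case=> e; rewrite e eqxx in ba.
    by case: eqP => // _ [e]; rewrite e eqxx in ba'.
  + move=> + [es]; rewrite -{s}es; case: eqP => _; first by case=> e; rewrite e eqxx in ba.
    by case: eqP => // _ [e]; rewrite e eqxx in ba'.
  case: (y =P j) => [->|_].
    move=> [<-]; case: (z =P j) => [->|_] //; case: eqP => // _ [/eqP].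
    by rewrite eq_sym (negPf aa').
  case: (y =P k) => [->|//] [<-]; case: (z =P j) => [_ [/eqP]|_].
    by rewrite (negPf aa').
  by case: eqP => // ->.
- move=> y s; rewrite /sg /sg2 misses_swap; case: eqP => [-> [<-]|_].
    by rewrite xK swcR t // eqxx.
  case: eqP => [-> [<-]|_]; first by rewrite (negPf jK) t // eqxx.
  by case: eqP => [-> [<-]|//]; case: ifP; rewrite ?sa' t // eqxx orbT.
set d := ext v sg _ in gd ed.
exists d; first exact: (R _ vf').
split=> //; exists a, b, (K :\ v :\ x); split.
  apply: (kclosed_hole vf n3 aa'); rewrite ?t ?eqxx ?orbT //.
  - apply: (kclosed_iso (K := K)) cl => [|y ny]; first by case: vf.
    rewrite !inE; case: eqP => // e; case/negP: ny; rewrite e.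
    by apply/andP; split; apply/missesP => z; rewrite (vcol_None _ vf).
  - by rewrite !inE eqxx.
  move=> y; rewrite !inE /sg2; case: eqP => [->|_]; first by rewrite (negPf jK) andbF.
  case: eqP => // _; rewrite tch_Some eq_sym (negPf aa') /= => /eqP e.
  by rewrite e eqxx in ba'.
apply: col_ext => y z; rewrite /hole /delv /swap /ext.
case: (y =P x) => [_|/eqP yx] /=; first by rewrite if_same.
case: (z =P x) => [_|/eqP zx] /=; first by rewrite if_same.
rewrite !inE yx /=; case: (y =P v) => [->|/eqP yv] /=.
  by rewrite /d /ext eqxx /sg (negPf zx).
rewrite /d /ext (negPf yv); case: (z =P v) => [_|zv] //.
rewrite /sg (negPf yx) /sg2; case: (y =P j) => [->|_].
  by rewrite (negPf jK).
by case: eqP => _ /=; rewrite ?sa' if_same.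
Qed.

Lemma near_hole v x j k a1 a2 f c : vcol v f -> nb3 v x j k ->
  equal_lists v f a1 a2 -> a1 != a2 -> (forall g, vcol v g -> rigid v g) ->
  near v f c -> exists p q d, [/\ (p, q) \in [:: (a1, a2); (a2, a1)], keq c d &
    near x (hole v x j k p q f) d].
Proof.
move=> vf n3 t a12 R [gc [a [b [K [cl ec]]]]].
have n := nb3_mem _ n3; have [jk xj xk [xv jv kv]] := nb3_neq n3.
pose P s := (s == a1) || (s == a2).
have nk := ext_not_constant (v := v) (y := x) _ gc; rewrite ec n inE eqxx in nk.
(* A swap of two colours both inside or both outside {a1, a2} keeps the lists equal, and then no
   extension [c] could exist. *)
have Pab : P a != P b.
  apply/eqP => e; case/negP: (nk isT); apply: (@equal_lists_constant _ _ a1 a2).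
  exact: equal_lists_swap.
wlog Pa : a b cl ec nk Pab / P a.
  move=> W; case: (boolP (P a)) => [|nPa]; first exact: W Pab.
  apply: (W b a); rewrite ?[swap b a _ _]swapC 1?eq_sym //; first exact: kclosedC.
  by move: Pab; rewrite (negPf nPa); case: (P b).
have Pb : ~~ P b by move: Pab; rewrite Pa; case: (P b).
(* Swapping [a] and [b] throughout the graph replaces [K] by its complement. *)
wlog xK : K c gc cl ec nk / x \in K.
  move=> W; case: (boolP (x \in K)) => [|nxK]; first exact: W ec nk.
  have clT : kclosed a b setT c by move=> y z; rewrite !inE.
  have ec' : delv v (swap a b setT c) = swap a b (~: K) f.
    rewrite delv_swap ec swap_symdiff; congr swap; apply/setP => y.
    by rewrite !inE; case: (y \in K).
  have gc' := gcol_swap clT gc.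
  have [| | |p [q [d [pq kd nd]]]] := W (~: K) (swap a b setT c) gc' _ ec' _ _.
  - exact: kclosed_compl.
  - by move=> _; rewrite -ec'; apply: (ext_not_constant (y := x)); rewrite // n inE eqxx.
  - by rewrite inE.
  by exists p, q, d; split=> //; apply: keq_trans (keq1 clT) kd.
have [a' [aa' ta aE]] : exists a', [/\ a != a', equal_lists v f a a' &
    ((a, a') == (a1, a2)) || ((a, a') == (a2, a1))].
  case/orP: Pa => /eqP->; first by exists a2; rewrite eqxx.
  exists a1; rewrite eqxx orbT eq_sym; split=> // y vy s.
  by rewrite t // orbC.
have ba : ~~ ((b == a) || (b == a')).
  by move: Pb aE; rewrite /P => + /orP[]/eqP[-> ->]; rewrite // orbC.
have [jK|jK] := boolP (j \in K); last first.
  have [d kd nd] := near_hole_in vf n3 ta aa' ba R cl xK jK gc ec.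
  by exists a, a', d; split=> //; rewrite !inE.
have [kK|kK] := boolP (k \in K); last first.
  have [d kd nd] := near_hole_in vf (nb3_swap n3) ta aa' ba R cl xK kK gc ec.
  exists a', a, d; rewrite hole_swap //; split=> //.
  by move: aE; rewrite !inE !xpair_eqE andbC [(a == a2) && _]andbC orbC.
case/negP: (nk isT); apply: lsts_constant => y z s.
rewrite !n !inE => yE zE; rewrite !misses_swap.
have -> : y \in K by case/or3P: yE => /eqP->.
have -> : z \in K by case/or3P: zE => /eqP->.
by rewrite !t ?n ?inE.
Qed.

(* If the configurations of both holes at [x] are even, the neighbours [y] and
   [z] of [x] other than [v] miss a common colour [m].  At most two of [j], [k],
   [z] lie on one [m]-[b1] chain, so for one of the holes the chain of [z]
   avoids [v], and swapping it makes [b1] common to all three lists. *)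
Lemma hole_odd v x j k a1 a2 b1 b2 f : vcol v f -> nb3 v x j k ->
  uniq [:: a1; a2; b1; b2] -> equal_lists v f a1 a2 ->
  exists2 g, vcol x g & ~~ even_lists (lsts x g).
Proof.
move=> vf n3 u4 t; have n := nb3_mem _ n3; have [pf ef] := vf.
have [jk xj xk [xv jv kv]] := nb3_neq n3.
have [vx vj vk] : [/\ E v x, E v j & E v k] by rewrite !n !inE !eqxx !orbT.
have [a12 b12] : a1 != a2 /\ b1 != b2.
  by move: u4; rewrite /= !inE !negb_or !andbT => /and3P[/and3P[-> _ _] _ ->].
pose A s := (s == a1) || (s == a2).
have nA s : ~~ A s = (s == b1) || (s == b2) by rewrite (four_compl s u4).
have [nA1 nA2] : ~~ A b1 /\ ~~ A b2 by rewrite !nA !eqxx orbT.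
have hv p q : A p -> A q -> p != q ->
    vcol x (hole v x j k p q f) /\ forall s, misses (hole v x j k p q f) v s = ~~ A s.
  move=> Ap Aq pq; have mp : misses f j p by rewrite t.
  have mq : misses f k q by rewrite t.
  split=> [|s]; first exact: hole_vcol.
  rewrite (hole_misses_v _ _ _ n3) /A -negb_or; congr negb; move: Ap Aq pq.
  by move=> /orP[]/eqP-> /orP[]/eqP->; rewrite ?eqxx // orbC.
have [Aa1 Aa2] : A a1 /\ A a2 by rewrite /A !eqxx orbT.
have [h1 mv1] := hv _ _ Aa1 Aa2 a12.
have [h2 mv2] := hv _ _ Aa2 Aa1 (negbT (etrans (eq_sym _ _) (negPf a12))).
case: (boolP (even_lists (lsts x (hole v x j k a1 a2 f)))) => [ev1|]; last first.
  by exists (hole v x j k a1 a2 f).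
case: (boolP (even_lists (lsts x (hole v x j k a2 a1 f)))) => [ev2|]; last first.
  by exists (hole v x j k a2 a1 f).
(* The list of [x] is {a1, a2}, so both [b1] and [b2] occur at [x]. *)
have [y fy] : exists y, f x y = Some b1 by apply/missesPn; rewrite t.
have [z fz] : exists z, f x z = Some b2 by apply/missesPn; rewrite t.
have nv w s : f x w = Some s -> w != v.
  by apply: contra_eq_neq => ->; rewrite (vcol_sym vf) (vcol_None _ vf).
have yz : y != z.
  by apply: contraNneq b12 => e; move: fz; rewrite -e fy => -[->].
have nx w s : f x w = Some s -> E x w by move=> e; have := ef x w; rewrite e => /esym/and3P[].
have [xy xz] := (nx _ _ fy, nx _ _ fz).
have [yv zv] := (nv _ _ fy, nv _ _ fz).
have [yx zx] : y != x /\ z != x by rewrite ![_ == x]eq_sym !edge_neq.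
have n3x : nb3 x v y z.
  by rewrite /nb3 /= !inE negb_or ![v == _]eq_sym yv zv yz xy xz Es vx.
have hm p q w s : A p -> A q -> p != q -> w != v -> w != x ->
    misses (hole v x j k p q f) w s =
    misses f w s && (sg2 j k p q w != Some s) || (f x w == Some s).
  by move=> Ap Aq pq wv wx; apply: hole_misses; rewrite ?t.
have sA p q w s : A p -> A q -> sg2 j k p q w = Some s -> A s.
  by move=> Ap Aq; rewrite /sg2; case: eqP => [_ [<-]|_] //; case: eqP => // _ [<-].
have sB p q w s : A p -> A q -> ~~ A s -> sg2 j k p q w != Some s.
  by move=> Ap Aq; apply: contraNneq; apply: sA.
have [a21 b21] : a2 != a1 /\ b2 != b1 by rewrite ![_ == b1]eq_sym ![_ == a1]eq_sym.
have fzb : misses f z b1 = false.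
  have := even_count b1 n3x ev1; rewrite mv1 nA1 !hm // fy eqxx orbT fz.
  by rewrite (inj_eq Some_inj) (negPf b21) orbF sB // andbT.
have fyb : misses f y b2 = false.
  have := even_count b2 n3x ev1; rewrite mv1 nA2 !hm // fz eqxx orbT fy.
  rewrite (inj_eq Some_inj) (negPf b12) orbF sB // andbT.
  by case: (misses f y b2).
have [m [my mb Am]] : exists m, [/\ misses (hole v x j k a1 a2 f) y m, m != b1 & A m].
  have := vcol_misses2 h1 xy; rewrite (cardsD1 b1) inE hm // fy eqxx orbT add1n => -[e].
  have : 0 < #|[set s | misses (hole v x j k a1 a2 f) y s] :\ b1| by rewrite e.
  rewrite card_gt0 => /set0Pn[m]; rewrite !inE => /andP[mb my]; exists m; split=> //.
  apply: contraTT my; rewrite nA (negPf mb) /= => /eqP->.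
  by rewrite hm // fyb fy (inj_eq Some_inj).
have [mb1 mb2] : b1 != m /\ b2 != m.
  by split; apply: contraTneq Am => <-.
have hym p q : A p -> A q -> p != q ->
    misses (hole v x j k p q f) y m = misses f y m && (sg2 j k p q y != Some m).
  by move=> Ap Aq pq; rewrite hm // fy (inj_eq Some_inj) (negPf mb1) orbF.
have hzm p q : A p -> A q -> p != q ->
    misses (hole v x j k p q f) z m = misses f z m && (sg2 j k p q z != Some m).
  by move=> Ap Aq pq; rewrite hm // fz (inj_eq Some_inj) (negPf mb2) orbF.
have sl p q w : p != q -> (sg2 j k p q w == Some p) = (w == j).
  move=> pq; rewrite /sg2; case: (w =P j) => [_|_]; first by rewrite eqxx.
  by case: (w =P k) => // _; rewrite (inj_eq Some_inj) eq_sym (negPf pq).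
have sr p q w : p != q -> (sg2 j k p q w == Some q) = (w == k).
  move=> pq; rewrite /sg2; case: (w =P j) => [->|_].
    by rewrite (inj_eq Some_inj) (negPf pq) (negPf jk).
  by case: (w =P k) => // _; rewrite eqxx.
have e1 := even_count m n3x ev1; have e2 := even_count m n3x ev2.
rewrite mv1 Am /= my /= in e1; move/negbFE in e1.
rewrite mv2 Am /= hym // hzm // in e2.
rewrite hym // in my; rewrite hzm // in e1.
(* The new edge coloured [m] goes to [j] in one hole and to [k] in the other, so evenness of both
   keeps [y] and [z] distinct from these two vertices. *)
have [[yj yk] [zj zk]] : (y != j /\ y != k) /\ (z != j /\ z != k).
  move: my e1 e2; case/orP: Am => /eqP->; rewrite !(sl, sr) //.
    move=> /andP[-> yj] /andP[-> zj] /=; rewrite yj zj.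
    case: (y =P k) => [yk|_]; case: (z =P k) => [zk|_] //= _.
    by rewrite yk zk eqxx in yz.
  move=> /andP[-> yj] /andP[-> zj] /=; rewrite yj zj.
  case: (y =P j) => [yk|_]; case: (z =P j) => [zk|_] //= _.
  by rewrite yk zk eqxx in yz.
have fzm : misses f z m by case/andP: e1.
have fym : misses f y m by case/andP: my.
pose f0 := delv x f; have pf0 : pcol f0 := pcol_delv x pf.
have ez : endpt m b1 f0 z.
  by rewrite /endpt !misses_delv // fzm fzb fz !(inj_eq Some_inj) (negPf b21).
have ejk w : E v w -> w != x -> w != y -> endpt m b1 f0 w.
  move=> vw wx wy; rewrite /endpt !misses_delv // !t // -!/(A _) Am (negPf nA1) /=.
  apply/eqP => /esym/eqP h; case/eqP: wy.
  by case: pf => _ _ /(_ _ _ _ _ h fy).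
have [ej ek] : endpt m b1 f0 j /\ endpt m b1 f0 k.
  by split; apply: ejk; rewrite // 1?eq_sym.
have last_step p q : A p -> A q -> p != q ->
    (forall w, sg2 j k p q w = Some m -> w \notin kcomp m b1 f0 z) ->
    exists2 g, vcol x g & ~~ even_lists (lsts x g).
  move=> Ap Aq pq hK; have [hvc mv] := hv _ _ Ap Aq pq.
  have [ph _] := hvc.
  have cl0 := @kcomp_closed _ _ m b1 _ z pf0.
  pose K := kcomp m b1 f0 z :\ v.
  have clK : kclosed m b1 K (hole v x j k p q f).
    apply: (kclosed_at (v := v) ph); rewrite ?(delv_hole _ _ _ _ _ vf).
      apply: (kclosed_iso (K := kcomp m b1 f0 z)) pf0 _ cl0 => w nw.
      rewrite !inE; case: eqP => // ew; case/negP: nw; rewrite ew.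
      apply/andP; split; apply/missesP => r; rewrite /f0 /delv;
        by case: ifP => // _; rewrite (vcol_None _ vf).
    move=> w; rewrite !inE eqxx /=; case: (eqVneq w x) => [->|wx].
      by rewrite /hole /delv eqxx orbT.
    rewrite (hole_v _ _ _ n3 wx) => /orP[/eqP/hK|/eqP/sA].
      by rewrite inE => /negPf->; rewrite andbF.
    by move=> /(_ Ap Aq); rewrite (negPf nA1).
  exists (swap m b1 K (hole v x j k p q f)); first exact: vcol_swap.
  apply: (odd_count (a := b1) n3x); rewrite !misses_swap swcR.
  have -> : (v \in K) = false by rewrite !inE eqxx.
  have -> : (z \in K) = true by rewrite !inE zv connect0.
  rewrite mv nA1 hzm // fzm /sg2 (negPf zj) (negPf zk) /=.
  (* On whichever side of the swap [y] lies, it misses [b1] afterwards, because it missed both [m]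
     and [b1]. *)
  case: ifP => _; last by rewrite hm // fy eqxx orbT.
  by rewrite hym // fym /sg2 (negPf yj) (negPf yk).
have [m' [Am' mm']] : exists m', A m' /\ m != m'.
  by case/orP: Am => /eqP->; [exists a2|exists a1].
case: (boolP (j \in kcomp m b1 f0 z)) => [jK|jK]; last first.
  apply: (last_step m m') => // w /eqP; rewrite sl // => /eqP->.
  exact: jK.
have m'm : m' != m by rewrite eq_sym.
apply: (last_step m' m) => // w /eqP; rewrite sr // => /eqP->.
by apply: (endpt_comp pf0 ez ej ek).
Qed.

Lemma hole_rigid v x j k a1 a2 b1 b2 f g : vcol v f -> nb3 v x j k ->
  uniq [:: a1; a2; b1; b2] -> equal_lists v f a1 a2 -> vcol x g -> rigid x g.
Proof.
move=> vf n3 u4 t vg; have [g0 v0 o0] := hole_odd vf n3 u4 t.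
have xv : E x v by rewrite Es (nb3_mem _ n3) inE eqxx.
exact: odd_all_rigid xv v0 o0 vg.
Qed.

(** * Swaps of complementary colour pairs *)

Lemma swc_in_swc a1 a2 b1 b2 s : uniq [:: a1; a2; b1; b2] ->
  ((swc a1 a2 s == b1) || (swc a1 a2 s == b2)) = ((s == b1) || (s == b2)).
Proof.
move=> u; apply: (@swc_pred (fun s => (s == b1) || (s == b2))).
by rewrite !(four_compl _ u) !eqxx orbT.
Qed.

Lemma swc_comm a1 a2 b1 b2 s : uniq [:: a1; a2; b1; b2] ->
  swc b1 b2 (swc a1 a2 s) = swc a1 a2 (swc b1 b2 s).
Proof.
move=> u; have hb := swc_in_swc s u; have ha := swc_in_swc s (four_rot u).
have c1 := four_compl s u.
have idb r : (r == b1) || (r == b2) = false -> swc b1 b2 r = r.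
  by case/norP=> ? ?; apply: swc_id.
have ida r : (r == a1) || (r == a2) = false -> swc a1 a2 r = r.
  by case/norP=> ? ?; apply: swc_id.
case: (boolP ((s == b1) || (s == b2))) => [hs|/negbTE hs].
  have na : (s == a1) || (s == a2) = false by apply: negbTE; rewrite -c1.
  by rewrite (ida s na) ida // ha.
by rewrite (idb s hs) idb // hb.
Qed.

Lemma tch_swap2 a1 a2 b1 b2 K f x y : uniq [:: a1; a2; b1; b2] ->
  tch b1 b2 (swap a1 a2 K f x y) = tch b1 b2 (f x y).
Proof.
move=> u; rewrite /swap; case: ifP => // _; case: (f x y) => //= s.
by rewrite !tch_Some swc_in_swc.
Qed.

Lemma kclosed_swap2 a1 a2 b1 b2 K K' f : uniq [:: a1; a2; b1; b2] ->
  kclosed b1 b2 K' f -> kclosed b1 b2 K' (swap a1 a2 K f).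
Proof. by move=> u cl x y; rewrite tch_swap2 //; apply: cl. Qed.

Lemma parallel_vcol v a1 a2 b1 b2 f g : uniq [:: a1; a2; b1; b2] -> vcol v f ->
  parallel a1 a2 b1 b2 f g -> vcol v g.
Proof.
move=> u vf [K [K' [cl cl' ->]]]; apply: vcol_swap; first exact: kclosed_swap2.
exact: vcol_swap.
Qed.

Lemma parallel_equal_lists v a1 a2 b1 b2 f g : uniq [:: a1; a2; b1; b2] ->
  equal_lists v f a1 a2 -> parallel a1 a2 b1 b2 f g -> equal_lists v g a1 a2.
Proof.
move=> u t [K [K' [_ _ ->]]]; apply: equal_lists_swap.
  by rewrite !(four_compl _ (four_rot u)) !eqxx orbT.
by apply: equal_lists_swap; rewrite // !eqxx orbT.
Qed.

Lemma parallel_refl a1 a2 b1 b2 f : parallel a1 a2 b1 b2 f f.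
Proof.
by exists set0, set0; rewrite !swap_none; split=> // x y; rewrite !inE.
Qed.

(** The neighbour [v] of [x] has list {b1, b2} in the hole, so the two pairs exchange roles. Swaps
    of complementary pairs commute, and reversing the colours of [vj] and [vk] is itself an
    [a1]-[a2] swap. *)
Lemma hole_parallel v x j k a1 a2 b1 b2 f g p q : vcol v f -> nb3 v x j k ->
  uniq [:: a1; a2; b1; b2] -> equal_lists v f a1 a2 -> parallel a1 a2 b1 b2 f g ->
  (p, q) \in [:: (a1, a2); (a2, a1)] ->
  parallel b1 b2 a1 a2 (hole v x j k a1 a2 f) (hole v x j k p q g).
Proof.
move=> vf n3 u t [K [K' [cl cl' ->]]] pqE; have n := nb3_mem _ n3; have [pf ef] := vf.
have [jk xj xk [xv jv kv]] := nb3_neq n3.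
have [vx vj vk] : [/\ E v x, E v j & E v k] by rewrite !n !inE !eqxx !orbT.
have a12 : a1 != a2 by move: u; rewrite /= !inE !negb_or => /andP[/andP[]].
have [tj tk] : iso a1 a2 f j /\ iso a1 a2 f k.
  by rewrite /iso !t // !eqxx orbT.
have [a1b a2b] : ((a1 == b1) || (a1 == b2) = false) /\ ((a2 == b1) || (a2 == b2) = false).
  by rewrite !(four_compl _ u) !eqxx orbT.
have isov a b : iso a b f v.
  by apply/andP; split; apply/missesP => r; rewrite (vcol_None _ vf).
have hp : pcol (hole v x j k a1 a2 f).
  by have [] := hole_vcol vf n3 a12 (_ : misses f j a1) (_ : misses f k a2);
    rewrite ?t ?eqxx ?orbT.
(* Since [j] and [k] miss [a1] and [a2] in [f], the path [jvk] is an entire [a1]-[a2] chain of the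
   hole colouring; it is exchanged exactly when [p], [q] come in reverse order. *)
pose Ka := [set y | if y \in [:: v; j; k] then p != a1 else y \in K].
exists (K' :\ v :\ x), Ka; split.
- apply: (kclosed_hole vf n3 a12); rewrite ?t ?eqxx ?orbT //.
  + apply: (kclosed_iso (K := K')) cl' => // y ny.
    by rewrite !inE; case: eqP => // e; rewrite e isov in ny.
  + by rewrite !inE eqxx.
  move=> y; rewrite /sg2; case: eqP => _; first by rewrite tch_Some a1b.
  by case: eqP => // _; rewrite tch_Some a2b.
- apply: (kclosed_at (v := v) hp); rewrite ?(delv_hole _ _ _ _ _ vf).
    apply: (kclosed_iso (K := K)) (kclosed_delv cl); first exact: pcol_delv.
    move=> y ny; rewrite !inE; case: ifP => // yE; case/negP: ny.
    have iy : iso a1 a2 f y by move: yE => /or3P[]/eqP->.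
    have isub r : misses f y r -> misses (delv x f) y r.
      by move=> /missesP h; apply/missesP => w; rewrite /delv; case: ifP.
    by case/andP: iy => i1 i2; apply/andP; split; apply: isub.
  move=> y; case: (eqVneq y x) => [->|yx]; first by rewrite /hole /delv eqxx orbT.
  rewrite (hole_v _ _ _ n3 yx) /sg2 !inE eqxx; case: (y =P j) => [->|_].
    by rewrite orbT.
  by case: (y =P k) => [->|//]; rewrite !orbT.
apply: col_ext => y z.
case: (eqVneq y x) => [->|yx].
  by rewrite /swap /hole /delv eqxx /= !if_same.
case: (eqVneq z x) => [->|zx].
  by rewrite /swap /hole /delv eqxx orbT /= !if_same.
have sgE w : omap (if p != a1 then swc a1 a2 else id) (sg2 j k a1 a2 w) = sg2 j k p q w.
  move: pqE; rewrite /sg2 !inE => /orP[]/eqP[-> ->].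
    by rewrite eqxx /=; case: eqP => //; case: eqP.
  rewrite eq_sym a12; case: eqP => _ /=; first by rewrite swcL.
  by case: eqP => _ //=; rewrite swcR.
have sgE' w : (if p != a1 then omap (swc a1 a2) (sg2 j k a1 a2 w) else sg2 j k a1 a2 w) =
    sg2 j k p q w.
  by rewrite -sgE; case: ifP => //; case: (sg2 _ _ _ _ _).
have yK' : y != v -> (y \in K' :\ v :\ x) = (y \in K') by rewrite !inE yx => ->.
have holeE c r s : hole v x j k r s c y z = ext v (sg2 j k r s) c y z.
  by rewrite /hole /delv (negPf yx) (negPf zx).
have swE a b L (c : col T 'I_4) (r w : T) : swap a b L c r w =
  if r \in L then omap (swc a b) (c r w) else c r w by [].
rewrite [RHS]swE [in RHS]swE !holeE /ext.
case: (eqVneq y v) => [->|yv].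
  by rewrite !inE eqxx /= andbF /= sgE'.
rewrite yK' //; case: (eqVneq z v) => [_|zv].
  have -> : (if y \in K' then omap (swc b1 b2) (sg2 j k a1 a2 y) else sg2 j k a1 a2 y)
      = sg2 j k a1 a2 y.
    case: ifP => // _; rewrite /sg2; case: eqP => _ /=.
      by case/norP: a1b => ? ?; rewrite swc_id.
    by case: eqP => //= _; case/norP: a2b => ? ?; rewrite swc_id.
  rewrite -sgE' !inE (negPf yv) /= /sg2; case: (y =P j) => [->|_] //=.
  by case: (y =P k) => // _; rewrite !if_same.
rewrite /swap !inE (negPf yv) /=; case: (boolP ((y == j) || (y == k))) => yE; last first.
  case: (y \in K); case: (y \in K') => //=; case: (f y z) => //= s.
  by rewrite swc_comm.
have /andP[i1 i2] : iso a1 a2 f y by case/orP: yE => /eqP->.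
have nt := misses_tch z i1 i2.
rewrite (omap_swc_id nt) if_same.
have nt' : ~~ tch a1 a2 (swap b1 b2 K' f y z) by rewrite (tch_swap2 _ _ _ _ (four_rot u)).
by move: nt'; rewrite /swap => /omap_swc_id->; rewrite if_same.
Qed.

Lemma near_keq w y h c e : E w y -> vcol w h -> (forall g, vcol w g -> rigid w g) ->
  near w h c -> gcol e -> delv w e = h -> keq e c.
Proof.
move=> wy vh R [gc [a [b [K [cl ec]]]]] ge ee.
by apply: (swap_ext_keq wy vh cl _ _ ge gc ee ec); apply: R => //; apply: vcol_swap.
Qed.

(** Both swaps preserve the list {a1, a2} of [v]. If the lists around [x] coincided after one of
    them, they would all be {a1, a2}, and undoing the swap would keep them so; but those of [h] do
    not coincide. Hence each intermediate colouring extends, and [swap_ext_keq] links the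
    extensions. *)
Lemma parallel_near_keq x v a1 a2 b1 b2 h g c e : E x v ->
  uniq [:: a1; a2; b1; b2] -> vcol x h -> (forall g, vcol x g -> rigid x g) ->
  (forall s, misses h v s = (s == a1) || (s == a2)) ->
  gcol e -> delv x e = h -> parallel a1 a2 b1 b2 h g -> near x g c -> keq e c.
Proof.
move=> xv u vh R mv ge ee pg ng; have vg := parallel_vcol u vh pg.
have := pg => -[K [K' [cl cl' eg]]].
have nh := ext_not_constant xv ge; rewrite ee in nh.
have inA b b' s : b \in [:: b1; b2] -> b' \in [:: b1; b2] ->
    ((swc b b' s == a1) || (swc b b' s == a2)) = ((s == a1) || (s == a2)).
  move=> hb hb'; apply: (@swc_pred (fun s => (s == a1) || (s == a2))).
  by move: hb hb'; rewrite !inE !(four_compl _ (four_rot u)) => -> ->.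
have inA' s : ((swc a1 a2 s == a1) || (swc a1 a2 s == a2)) = ((s == a1) || (s == a2)).
  by apply: (@swc_pred (fun s => (s == a1) || (s == a2))); rewrite !eqxx orbT.
have v1 : vcol x (swap a1 a2 K h) := vcol_swap cl vh.
have n1 : ~~ constant (lsts x (swap a1 a2 K h)).
  apply: contraNN nh => /lsts_eq k.
  rewrite -(swapK a1 a2 K h); apply: (@equal_lists_constant _ _ a1 a2).
  apply: equal_lists_swap; rewrite ?eqxx ?orbT // => y xy s.
  by rewrite (k y v) // misses_swap; case: ifP => _; rewrite mv ?inA'.
have n2 : ~~ constant (lsts x g).
  apply: contraNN n1 => /lsts_eq k.
  rewrite -(swapK b1 b2 K' (swap a1 a2 K h)) -eg; apply: (@equal_lists_constant _ _ a1 a2).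
  apply: equal_lists_swap; first by rewrite !(four_compl _ (four_rot u)) !eqxx orbT.
  move=> y xy s; rewrite (k y v) // eg !misses_swap.
  by do 2! case: ifP => _; rewrite mv ?inA' ?inA // !inE !eqxx ?orbT.
have [e1 g1 d1] := not_constant_ext xv v1 n1.
have [e2 g2 d2] := not_constant_ext xv vg n2.
apply: keq_trans (swap_ext_keq xv vh cl (R _ vh) (R _ v1) ge g1 ee d1) _.
have cl2 : kclosed b1 b2 K' (swap a1 a2 K h) by apply: kclosed_swap2.
rewrite eg in vg d2 ng.
apply: keq_trans (swap_ext_keq xv v1 cl2 (R _ v1) (R _ vg) g1 g2 d1 d2) _.
exact: near_keq xv vg R ng g2 d2.
Qed.

(* Induction along the [a1]-[b1] chain that starts at [x]: moving the hole from
   the edge [vx] to the next edge [xy] of the chain shortens it. *)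
Lemma parallel_near n v x a1 a2 b1 b2 f g1 g2 c1 c2 :
  #|kcomp a1 b1 f x| <= n -> vcol v f -> E v x ->
  uniq [:: a1; a2; b1; b2] -> equal_lists v f a1 a2 ->
  parallel a1 a2 b1 b2 f g1 -> parallel a1 a2 b1 b2 f g2 ->
  near v g1 c1 -> near v g2 c2 -> keq c1 c2.
Proof.
elim: n v x a1 a2 b1 b2 f g1 g2 c1 c2 => [|n IHn] v x a1 a2 b1 b2 f g1 g2 c1 c2.
  by rewrite leqn0 cards_eq0 => /eqP e; have := kcomp_self a1 b1 f x; rewrite e inE.
move=> sz vf vx u t p1 p2 nr1 nr2; have [pf ef] := vf.
have a12 : a1 != a2 by move: u; rewrite /= !inE !negb_or => /andP[/andP[]].
have a1b : a1 != b1 by move: u; rewrite /= !inE !negb_or => /andP[/and3P[]].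
have a2b : a2 != b1 by move: u; rewrite /= !inE !negb_or => /and3P[_ /andP[]].
have ep w : E v w -> endpt a1 b1 f w.
  by move=> vw; rewrite /endpt !t // eqxx ![b1 == _]eq_sym (negPf a1b) (negPf a2b).
(* An [a1]-[b1] chain has at most two ends, so that of [x] avoids one of the other two neighbours of
   [v]; this one is taken as [j], and [vj] receives [a1]. *)
have [j [k [n3 jn]]] : exists j k, nb3 v x j k /\ j \notin kcomp a1 b1 f x.
  have [j [k n3]] := nb3_ex vx; have [jk xj xk _] := nb3_neq n3.
  case: (boolP (j \in kcomp a1 b1 f x)) => [jK|]; last by exists j, k.
  exists k, j; split; first exact: nb3_swap.
  have N := nb3_mem _ n3.
  by apply: endpt_comp jK; rewrite ?ep ?N ?inE ?eqxx ?orbT.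
have N := nb3_mem _ n3; have [jk xj xk [xv jv kv]] := nb3_neq n3.
have [vj vk] : E v j /\ E v k by rewrite !N !inE !eqxx !orbT.
pose h := hole v x j k a1 a2 f.
have Rv g : vcol v g -> rigid v g.
  by move=> vg; apply: (odd_all_rigid vx vf _ vg); apply: equal_lists_odd vx a12 t.
have Rx g : vcol x g -> rigid x g by apply: hole_rigid vf n3 u t.
have mj : misses f j a1 by rewrite t // eqxx.
have mk : misses f k a2 by rewrite t // eqxx orbT.
have vh : vcol x h := hole_vcol vf n3 a12 mj mk.
have xvE : E x v by rewrite Es.
have mv s : misses h v s = (s == b1) || (s == b2).
  by rewrite (hole_misses_v _ _ _ n3) (four_compl s u) negb_or.
have toh g c : parallel a1 a2 b1 b2 f g -> near v g c -> exists h' d,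
    [/\ parallel b1 b2 a1 a2 h h', near x h' d & keq c d].
  move=> pg nc.
  have [p [q [d [pq kd nd]]]] := near_hole (parallel_vcol u vf pg) n3 (parallel_equal_lists u t pg) a12 Rv nc.
  exists (hole v x j k p q g), d; split=> //.
  exact: hole_parallel vf n3 u t pg pq.
have [h1 [d1 [q1 m1 k1]]] := toh _ _ p1 nr1.
have [h2 [d2 [q2 m2 k2]]] := toh _ _ p2 nr2.
apply: keq_trans k1 (keq_trans _ (keq_sym k2)).
case: (boolP (constant (lsts x h))) => [/lsts_eq k0|nc]; last first.
  have [e ge ee] := not_constant_ext xvE vh nc.
  have H := parallel_near_keq xvE (four_rot u) vh Rx mv ge ee.
  exact: keq_trans (keq_sym (H _ _ q1 m1)) (H _ _ q2 m2).
(* The lists around [x] coincide again, now with {b1, b2}, the list of [v]; the hole moves on to the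
   edge [xy] of colour [b1]. *)
have th : equal_lists x h b1 b2 by move=> y xy s; rewrite (k0 y v).
have [y fy] : exists y, f x y = Some b1.
  by apply/missesPn; rewrite t // negb_or ![b1 == _]eq_sym a1b a2b.
have xy : E x y by have := ef x y; rewrite fy => /esym/and3P[].
apply: (IHn x y b1 b2 a1 a2 h h1 h2 d1 d2 _ vh xy (four_rot u) th q1 q2 m1 m2).
(* The chain of [y] in the hole colouring lies inside that of [x] in [f] and no longer contains
   [x]. *)
rewrite -ltnS; apply: leq_trans sz; apply: proper_card; apply/properP; split; last first.
  exists x; first exact: kcomp_self.
  have cl : kclosed b1 a1 (~: [set x]) h.
    move=> w z e; rewrite !inE; move: e; rewrite /h /hole /delv.
    by case: (w =P x) => [_|_] //=; case: (z =P x).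
  apply: contraL (_ : x \notin ~: [set x]) => [hx|]; last by rewrite !inE eqxx.
  rewrite negbK; apply: (subsetP (kcomp_sub cl _)) hx.
  by rewrite !inE; apply: contraTneq xy => ->; rewrite Ei.
have clf := @kcomp_closed _ _ a1 b1 _ x pf.
have vnx : v \notin kcomp a1 b1 f x.
  have cl : kclosed a1 b1 (~: [set v]) f.
    move=> w z e; rewrite !inE; move: e.
    case: (w =P v) => [->|_]; first by rewrite (vcol_None _ vf).
    by case: (z =P v) => [->|//]; rewrite (vcol_sym vf) (vcol_None _ vf).
  apply/negP => /(subsetP (kcomp_sub cl _)); rewrite !inE eqxx.
  by move=> /(_ xv).
have clh : kclosed a1 b1 (kcomp a1 b1 f x :\ x) h.
  apply: kclosed_hole => // w; rewrite /sg2; case: eqP => [->|_] //.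
  case: eqP => // _; rewrite tch_Some [a2 == a1]eq_sym (negPf a12) /=.
  by rewrite (negPf a2b).
apply: subset_trans (kcomp_sub (kclosedC clh) _) (subsetDl _ _).
rewrite !inE; apply/andP; split; first by apply: contraTneq xy => ->; rewrite Ei.
apply: connect1.
by rewrite fy tch_Some eqxx orbT.
Qed.

(** * Transport of near extensions along swaps *)

Lemma near_same v x f c d : E v x -> vcol v f -> (forall g, vcol v g -> rigid v g) ->
  near v f c -> near v f d -> keq c d.
Proof.
move=> vx vf R nc nd; case: (boolP (constant (lsts v f))) => [k|nk].
  have [a1 [a2 [a12 t]]] := constant_lsts vx vf k; have [b1 [b2 u]] := four_ex a12.
  apply: (parallel_near (leqnn _) vf vx u t _ _ nc nd); exact: parallel_refl.
have [e ge ee] := not_constant_ext vx vf nk.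
exact: keq_trans (keq_sym (near_keq vx vf R nc ge ee)) (near_keq vx vf R nd ge ee).
Qed.

(** As swapping [K] leaves the lists equal, [K] contains all neighbours of [v] or none. The [a]-[b]
    chain of [x] contains [x] but not all three, so its symmetric difference with [K] makes the
    lists differ. The extension found is one swap away both from [f] and from [swap a b K f]. *)
Lemma mixed_ext v x f a a' b K : vcol v f -> E v x -> equal_lists v f a a' ->
  a != b -> a' != b -> kclosed a b K f -> constant (lsts v (swap a b K f)) ->
  exists2 Q, kclosed a b Q f &
  exists2 e, gcol e & delv v e = swap a b (symdiff Q K) f.
Proof.
move=> vf vx t ab a'b cl k; have [pf _] := vf.
have ba : (b == a) || (b == a') = false by rewrite ![b == _]eq_sym (negPf ab) (negPf a'b).
have ma y : E v y -> misses f y a by move=> vy; rewrite t // eqxx.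
have mb y : E v y -> misses f y b = false by move=> vy; rewrite t // ba.
have ep y : E v y -> endpt a b f y by move=> vy; rewrite /endpt ma // mb.
have clQ := @kcomp_closed _ _ a b _ x pf.
exists (kcomp a b f x) => //; apply: (not_constant_ext vx).
  by apply: vcol_swap vf; apply: kclosed_symdiff.
have [y [z n3]] := nb3_ex vx; have [yz xy xz _] := nb3_neq n3.
have N := nb3_mem _ n3.
have [w vw wQ] : exists2 w, E v w & w \notin kcomp a b f x.
  case: (boolP (y \in kcomp a b f x)) => [yQ|]; last first.
    by exists y; rewrite // N !inE eqxx orbT.
  exists z; first by rewrite N !inE eqxx !orbT.
  by apply: endpt_comp yQ; rewrite ?ep ?N ?inE ?eqxx ?orbT.
apply/negP => /lsts_eq/(_ x w a vx vw); move/lsts_eq: k => /(_ x w a vx vw).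
rewrite !misses_swap !inE -!/(kcomp a b f x) connect0 swcL.
have -> : connect (fun u r => tch a b (f u r)) x w = false.
  by move: wQ; rewrite inE => /negPf.
by case: (x \in K); case: (w \in K); rewrite //= ?ma ?mb.
Qed.

Lemma near_ex v x f : E v x -> vcol v f -> exists c, near v f c.
Proof.
move=> vx vf; case: (boolP (constant (lsts v f))) => [k|nk]; last first.
  by have [e ge ee] := not_constant_ext vx vf nk; exists e; apply: near_ext.
have [a1 [a2 [a12 t]]] := constant_lsts vx vf k; have [b1 [b2 u]] := four_ex a12.
have [a1b a2b] : a1 != b1 /\ a2 != b1.
  by move: u; rewrite /= !inE !negb_or => /and3P[/and3P[_ -> _] /andP[-> _] _].
have cl0 : kclosed a1 b1 set0 f by move=> y z; rewrite !inE.
have [|Q clQ [e ge ee]] := mixed_ext vf vx t a1b a2b cl0; first by rewrite swap_none.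
exists e; split=> //; exists a1, b1, (symdiff Q set0); split=> //.
exact: kclosed_symdiff.
Qed.

(** If one of the two colourings extends, its extension is near both. Otherwise both have equal
    lists: when [a] and [b] are both inside or both outside the common list of [f], the swap is
    parallel; when just one is inside, [mixed_ext] yields a colouring near both. *)
Lemma near_step v x f a b K c d : E v x -> vcol v f ->
  (forall g, vcol v g -> rigid v g) -> kclosed a b K f ->
  near v f c -> near v (swap a b K f) d -> keq c d.
Proof.
move=> vx vf R cl nc nd.
have vf' : vcol v (swap a b K f) := vcol_swap cl vf.
have cl' : kclosed a b K (swap a b K f) by apply/kclosed_swap.
have meet e : near v f e -> near v (swap a b K f) e -> keq c d.
  by move=> n1 n2; apply: keq_trans (near_same vx vf R nc n1) (near_same vx vf' R n2 nd).
case: (boolP (constant (lsts v f))) => [k|nk]; last first.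
  have [e ge ee] := not_constant_ext vx vf nk; apply: (meet e); first exact: near_ext.
  by split=> //; exists a, b, K; rewrite swapK.
case: (boolP (constant (lsts v (swap a b K f)))) => [k'|nk]; last first.
  have [e ge ee] := not_constant_ext vx vf' nk.
  apply: (meet e); last exact: near_ext.
  by split=> //; exists a, b, K.
have cl0 r s g : kclosed r s set0 g by move=> y z; rewrite !inE.
have [ab|ab] := eqVneq a b.
  by move: nd; rewrite ab swap_same => nd; apply: (near_same vx vf R nc nd).
have [a1 [a2 [a12 t]]] := constant_lsts vx vf k.
pose P s := (s == a1) || (s == a2).
have trab r s : P r -> P s -> r != s -> equal_lists v f r s.
  move=> hr hs rs y vy m; rewrite t //; move: hr hs rs.
  by move=> /orP[]/eqP-> /orP[]/eqP->; rewrite ?eqxx // orbC.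
case: (boolP (P a)) => Pa; case: (boolP (P b)) => Pb.
- have t' := trab a b Pa Pb ab; have [b1 [b2 u]] := four_ex ab.
  apply: (parallel_near (leqnn _) vf vx u t' _ _ nc nd); first exact: parallel_refl.
  by exists K, set0; rewrite swap_none.
- have [a' Pa' aa'] : exists2 a', P a' & a != a'.
    by case/orP: Pa => /eqP->; [exists a2|exists a1]; rewrite /P ?eqxx ?orbT // eq_sym.
  have a'b : a' != b by apply: contraTneq Pa' => ->.
  have [Q clQ [e ge ee]] := mixed_ext vf vx (trab _ _ Pa Pa' aa') ab a'b cl k'.
  apply: (meet e); split=> //.
    by exists a, b, (symdiff Q K); split=> //; apply: kclosed_symdiff.
  by exists a, b, Q; rewrite swap_symdiff; split=> //; apply/kclosed_swap.
- have [b' Pb' bb'] : exists2 b', P b' & b != b'.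
    by case/orP: Pb => /eqP->; [exists a2|exists a1]; rewrite /P ?eqxx ?orbT // eq_sym.
  have b'a : b' != a by apply: contraTneq Pb' => ->.
  have ba : b != a by rewrite eq_sym.
  rewrite swapC in k'.
  have [Q clQ [e ge ee]] := mixed_ext vf vx (trab _ _ Pb Pb' bb') ba b'a (kclosedC cl) k'.
  have clQ' := kclosedC clQ; rewrite swapC in ee.
  apply: (meet e); split=> //.
    by exists a, b, (symdiff Q K); split=> //; apply: kclosed_symdiff.
  by exists a, b, Q; rewrite swap_symdiff; split=> //; apply/kclosed_swap.
have u : uniq [:: a1; a2; a; b].
  rewrite /= !inE !negb_or a12 ab !andbT /= ![a1 == _]eq_sym ![a2 == _]eq_sym.
  by move: Pa Pb => /norP[-> ->] /norP[-> ->].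
apply: (parallel_near (leqnn _) vf vx u t _ _ nc nd); first exact: parallel_refl.
by exists set0, K; rewrite swap_none.
Qed.

(** For a suitable [v] all colourings of G - v are rigid. Along a swap sequence from [delv v c] to
    [delv v d], provided by [IH], all near extensions stay equivalent to [c]. *)
Lemma cubic_keq c d : gcol c -> gcol d -> keq c d.
Proof.
move=> gc gd; case: (pickP [pred q : T * T | E q.1 q.2]) => [[u x] /= ux|noE]; last first.
  have N e : gcol e -> forall y z, e y z = None.
    by move=> [_ ee] y z; have := noE (y, z); rewrite /= -ee; case: (e y z).
  by rewrite (_ : c = d); [apply: keq_refl|apply: col_ext => y z; rewrite !N].
have [v [y [f0 [vy v0 od]]]] := odd_exists gc ux.
have R g : vcol v g -> rigid v g := odd_all_rigid vy v0 od.
have vc := vcol_delv v gc; have vd := vcol_delv v gd.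
suff H g : keq (delv v c) g -> forall e, near v g e -> keq c e.
  by apply: (H _ (IH vy vc vd)); apply: near_ext.
elim=> [|{}g a b K kg IHg cl] e ne.
  by apply: (near_same vy vc R _ ne); apply: near_ext.
have vg : vcol v g.
  split; first by apply: keq_pcol kg _; case: vc.
  by move=> w z; rewrite (keq_isSome _ _ kg); case: vc.
have [e' ne'] := near_ex vy vg.
exact: keq_trans (IHg _ ne') (near_step vy vg R cl ne' ne).
Qed.

End Cubic.

(** * Subcubic graphs *)

Section Subcubic.
Variable T : finType.

(** Ordered pairs are counted, so each edge counts twice; the induction only needs a strict
    decrease. *)
Definition support (C : finType) (c : col T C) :=
  [set q : T * T | isSome (c q.1 q.2)].

Lemma support_sub (C : finType) (c d : col T C) v x :
  (forall y z, isSome (d y z) -> isSome (c y z)) ->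
  isSome (c v x) -> d v x = None -> #|support d| < #|support c|.
Proof.
move=> h cvx dvx; apply: proper_card; apply/properP; split.
  by apply/subsetP => q; rewrite !inE; apply: h.
by exists (v, x); rewrite inE //= dvx.
Qed.

(** The bound [deg c x < k] stands in for k = Delta + 1: it survives deletions with [k] fixed, even
    if the maximum degree drops. *)
Lemma keq_subcubic n k (c d : col T 'I_k) : #|support c| <= n -> k <= 4 ->
  pcol c -> pcol d -> (forall x y, isSome (d x y) = isSome (c x y)) ->
  (forall x, deg c x < k) -> keq c d.
Proof.
elim: n k c d => [|n IHn] k c d.
  rewrite leqn0 cards_eq0 => /eqP s0 _ _ _ sd _.
  have c0 y z : isSome (c y z) = false.
    by have := in_set0 (y, z); rewrite -s0 inE.
  rewrite (_ : c = d); first exact: keq_refl.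
  apply: col_ext => y z; have := c0 y z; have := sd y z.
  by case: (c y z) => //; case: (d y z).
move=> sz k4 pc pd sd dk.
case: (pickP [pred v | (0 < deg c v) && (deg c v <= 2)]) => [v /andP[v0 v2]|big].
  have [x] : exists x, x \in [set y | isSome (c v y)] by apply/set0Pn; rewrite -card_gt0.
  rewrite inE; case cs : (c v x) => [s|//] _.
  have [t dt] : exists t, d v x = Some t.
    by have := sd v x; rewrite cs; case: (d v x) => // t; exists t.
  have [sc ic _] := pc.
  have vx : v != x by apply: contraTneq isT => e; move: cs; rewrite -e ic.
  pose c' := dele v x c; pose d' := dele v x d.
  have sub y z : isSome (c' y z) -> isSome (c y z) by rewrite /c' /dele; case: ifP.
  have c'vx : c' v x = None by rewrite /c' /dele eqxx.
  have c'xv : c' x v = None by rewrite /c' /dele eqxx orbT.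
  have degS y z : c' y z = None -> isSome (c y z) -> deg c' y < deg c y.
    move=> n1 n2; apply: proper_card; apply/properP; split.
      by apply/subsetP => w; rewrite !inE; apply: sub.
    by exists z; rewrite !inE // n1.
  have degle y : deg c' y <= deg c y.
    by apply/subset_leq_card/subsetP => w; rewrite !inE; apply: sub.
  have kcd : keq c' d'.
    apply: IHn => //; try exact: pcol_dele.
    - rewrite -ltnS; apply: leq_trans sz.
      by apply: (support_sub (v := v) (x := x)); rewrite // cs.
    - by move=> y z; rewrite /c' /d' /dele; case: ifP.
    by move=> y; apply: leq_ltn_trans (degle y) (dk y).
  rewrite -(dele_adde pc cs) -(dele_adde pd dt).
  apply: (edge_lift kcd (pcol_dele v x pc) vx); rewrite ?card_ord.
  - apply: leq_ltn_trans (dk x); apply: (degS x v) => //.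
    by rewrite sc cs.
  - rewrite -ltnS; apply: leq_trans v2; apply: (degS v x) => //.
    by rewrite cs.
  - exact: fits_dele.
  exact: fits_dele.
case: (pickP (mem (support c))) => [[v0 x0]|s0]; last first.
  apply: (IHn k c d) => //; rewrite (_ : support c = set0) ?cards0 //.
  by apply/setP => q; rewrite [RHS]inE; apply: s0.
move=> e0'; have e0 : isSome (c v0 x0) by move: e0'; rewrite /= inE.
pose E : rel T := fun x y => isSome (c x y).
(* No vertex of degree one or two is left, so every vertex with an edge has degree three, which with
   [deg < k <= 4] forces [k = 4]. *)
have deg3 v x : isSome (c v x) -> deg c v = 3.
  move=> vx; apply/eqP; rewrite eqn_leq -ltnS (leq_trans (dk v) k4) /=.
  have := big v; rewrite /= (_ : 0 < deg c v) /=; last first.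
    by rewrite card_gt0; apply/set0Pn; exists x; rewrite inE.
  by move/negbT; rewrite -ltnNge.
have ek : k = 4.
  by apply/eqP; rewrite eqn_leq k4; have := dk v0; rewrite (deg3 _ _ e0).
subst k.
have [sc ic _] := pc.
have Es : symmetric E by move=> x y; rewrite /E sc.
have Ei : irreflexive E by move=> x; rewrite /E ic.
have E3 x y : E x y -> #|[set z | E x z]| = 3 by apply: deg3.
apply: (cubic_keq Es Ei E3) => // v y f g vy [pf ef] [pg eg].
have fsub w z : isSome (f w z) -> isSome (c w z) by rewrite ef => /and3P[].
apply: IHn => //.
- rewrite -ltnS; apply: leq_trans sz; apply: (support_sub (v := v) (x := y)) => //.
  by have := ef v y; rewrite eqxx andbF; case: (f v y).
- by move=> w z; rewrite ef eg.
move=> w; apply: leq_ltn_trans (dk w).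
by apply/subset_leq_card/subsetP => z; rewrite !inE; apply: fsub.
Qed.

End Subcubic.

(** * Kempe changes of graph colourings *)

Section Bridge.
Variables (G : sgraph) (k : nat).
Implicit Types (c d : colouring G k) (a b : 'I_k).

Definition tocol c : col G 'I_k :=
  fun x y => omap (sval c) (insub [set x; y] : option (edge G)).

Lemma edgeE x y : ([set x; y] \in edges G) = sedge x y.
Proof.
rewrite inE; apply/existsP/idP => [[u /existsP[v /andP[uv /eqP e]]]|xy]; last first.
  by exists x; apply/existsP; exists y; rewrite xy eqxx.
have nuv : u != v by apply: contraTneq uv => ->; rewrite sedge_irrefl.
have xe : x \in [set u; v] by rewrite -e !inE eqxx.
have ye : y \in [set u; v] by rewrite -e !inE eqxx orbT.
have ue : u \in [set x; y] by rewrite e !inE eqxx.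
have ve : v \in [set x; y] by rewrite e !inE eqxx orbT.
move: xe ye ue ve; rewrite !inE.
case/orP=> /eqP->; case/orP=> /eqP->;
  rewrite ?(negPf nuv) ?[v == u]eq_sym ?(negPf nuv) ?eqxx //.
by rewrite sedge_sym.
Qed.

Lemma edge_ex (f : edge G) : exists x y, sedge x y /\ val f = [set x; y].
Proof.
case: f => f /= fE; have := fE; rewrite inE.
by case/existsP=> x /existsP[y /andP[xy /eqP->]]; exists x, y.
Qed.

Lemma tocol_edge c (f : edge G) x y : val f = [set x; y] ->
  tocol c x y = Some (sval c f).
Proof.
move=> e; rewrite /tocol; case: insubP => [g _ eg|].
  by rewrite /=; congr (Some (sval c _)); apply: val_inj; rewrite eg.
by rewrite -e => /negP[]; apply: valP.
Qed.

Lemma tocol_isSome c x y : isSome (tocol c x y) = sedge x y.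
Proof.
rewrite /tocol -edgeE; case: insubP => [g -> _ //|/negPf-> //].
Qed.

Lemma tocolP c x y a : tocol c x y = Some a ->
  exists2 f : edge G, val f = [set x; y] & sval c f = a.
Proof.
rewrite /tocol; case: insubP => //= f _ ef [<-]; by exists f.
Qed.

Lemma tocol_pcol c : pcol (tocol c).
Proof.
split=> [x y|x|x y z a].
- by rewrite /tocol setUC.
- have := tocol_isSome c x x; rewrite sedge_irrefl.
  by case: (tocol c x x).
move=> /tocolP[f ef cf] /tocolP[g eg cg].
have [fg|fg] := eqVneq f g.
  have nf u v : val f = [set u; v] -> u != v.
    move=> e; have := valP f; rewrite e edgeE => h.
    by apply: contraTneq h => ->; rewrite sedge_irrefl.
  have yf : y \in val f by rewrite ef !inE eqxx orbT.
  move: yf; rewrite fg eg !inE => /orP[/eqP yx|/eqP//].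
  by have := nf _ _ ef; rewrite yx eqxx.
have := valP c => /forallP/(_ f)/forallP/(_ g)/implyP.
rewrite /adjacent fg /= => /(_ _)/negP[]; last by rewrite cf cg.
by apply/set0Pn; exists x; rewrite ef eg !inE eqxx.
Qed.

Lemma tocol_inj : injective tocol.
Proof.
move=> c d e; apply/val_inj/ffunP => f; have [x [y [_ ef]]] := edge_ex f.
by have := tocol_edge c ef; rewrite e (tocol_edge d ef) => -[].
Qed.

Lemma kempe_relE c a b x y :
  kempe_rel (sval c) a b x y = tch a b (tocol c x y).
Proof.
apply/existsP/idP => [[f /andP[/eqP ef]]|].
  by rewrite (tocol_edge c ef) !inE.
case/orP=> /eqP/tocolP[f ef cf]; exists f; rewrite ef cf eqxx !inE eqxx //.
by rewrite orbT.
Qed.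

Lemma swc_tperm a b s : tperm a b s = swc a b s.
Proof. by rewrite permE /= /swc. Qed.

Lemma kempe_swapE c a b v x y (f : edge G) : val f = [set x; y] ->
  Some (kempe_swap (sval c) a b v f) =
  swap a b (kcomp a b (tocol c) v) (tocol c) x y.
Proof.
move=> ef; rewrite ffunE /swap (tocol_edge c ef) /= inE.
have compE u : connect (kempe_rel (sval c) a b) v u =
               (u \in kcomp a b (tocol c) v).
  by rewrite inE; apply: eq_connect => u1 u2; apply: kempe_relE.
have tE : (sval c f \in [set a; b]) = tch a b (tocol c x y).
  by rewrite (tocol_edge c ef) tch_Some !inE.
rewrite tE; case: (boolP (tch _ _ _)) => [h|h] /=; last first.
  move: h; rewrite (tocol_edge c ef) tch_Some => /norP[h1 h2].
  by rewrite swc_id ?if_same.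
have cl := @kcomp_closed _ _ a b _ v (tocol_pcol c).
(* Both ends of an edge coloured [a] or [b] lie in the same component, so the condition on both ends
   reduces to one on [x]. *)
have -> : [forall u in val f, connect (kempe_rel (sval c) a b) v u] =
          (x \in kcomp a b (tocol c) v).
  apply/forall_inP/idP => [H|H u].
    by rewrite -compE; apply: H; rewrite ef !inE eqxx.
  rewrite compE ef => /set2P[]->; last rewrite -(cl _ _ h); exact: H.
by case: ifP => // _; rewrite swc_tperm.
Qed.

Lemma kempe_swap_proper c a b v : proper_colouring (kempe_swap (sval c) a b v).
Proof.
have [_ _ pc] := pcol_swap (@kcomp_closed _ _ a b _ v (tocol_pcol c)) (tocol_pcol c).
apply/forallP => f; apply/forallP => g; apply/implyP => /andP[fg /set0Pn[x]].
rewrite inE => /andP[xf xg]; apply: contraNneq fg => e; apply/eqP.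
have E (h : edge G) : x \in val h -> exists y, val h = [set x; y].
  have [u [w [_ ->]]] := edge_ex h; rewrite !inE => /orP[]/eqP->.
    by exists w.
  by exists u; rewrite setUC.
have [y ey] := E _ xf; have [z ez] := E _ xg.
have e1 := kempe_swapE c a b v ey; rewrite e in e1.
have e2 := kempe_swapE c a b v ez.
by apply/val_inj; rewrite ey ez (pc x y z _ (esym e1) (esym e2)).
Qed.

Definition kswap c a b v : colouring G k :=
  exist (fun e => is_true (proper_colouring e)) _ (kempe_swap_proper c a b v).

Lemma tocol_kswap c a b v :
  tocol (kswap c a b v) = swap a b (kcomp a b (tocol c) v) (tocol c).
Proof.
apply: col_ext => x y; case: (boolP (sedge x y)) => [xy|nxy].
  have xyE : [set x; y] \in edges G by rewrite edgeE.
  by rewrite (@tocol_edge _ (Sub [set x; y] xyE : edge G)) // -(@kempe_swapE _ _ _ _ _ _ (Sub [set x; y] xyE : edge G)).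
have := tocol_isSome (kswap c a b v) x y.
have := isSome_swap a b (kcomp a b (tocol c) v) (tocol c) x y.
rewrite [isSome (tocol c x y)]tocol_isSome (negPf nxy).
by case: (swap _ _ _ _) => //; case: (tocol _ _ _).
Qed.

Lemma kempe_equiv_refl c : kempe_equiv c c. Proof. exact: connect0. Qed.

Lemma kswap_equiv c a b v : a != b -> kempe_equiv c (kswap c a b v).
Proof.
move=> ab; apply: connect1; apply/orP; left.
by apply/existsP; exists a; apply/existsP; exists b; apply/existsP; exists v;
  rewrite ab eqxx.
Qed.

(* A swap on a closed set is performed one component at a time. *)
Lemma swap_kempe_equiv n c a b (K : {set G}) : #|K| <= n ->
  kclosed a b K (tocol c) ->
  exists2 d, tocol d = swap a b K (tocol c) & kempe_equiv c d.
Proof.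
have [->|ab] := eqVneq a b.
  by exists c; [rewrite swap_same|apply: kempe_equiv_refl].
elim: n c K => [|n IH] c K.
  rewrite leqn0 cards_eq0 => /eqP-> _.
  by exists c; [rewrite swap_none|apply: kempe_equiv_refl].
case: (set_0Vmem K) => [->|[v vK]] Kn cl.
  by exists c; [rewrite swap_none|apply: kempe_equiv_refl].
set V := kcomp a b (tocol c) v.
have VK : V \subset K := kcomp_sub cl vK.
have cV : kclosed a b V (tocol c) := @kcomp_closed _ _ a b _ v (tocol_pcol c).
have [||d dE cd] := IH (kswap c a b v) (K :&: ~: V).
- rewrite -ltnS; apply: leq_trans Kn; apply: proper_card; apply/properP.
  split; first exact: subsetIl.
  by exists v => //; rewrite !inE connect0 andbF.
- rewrite tocol_kswap; apply/kclosed_swap.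
  by apply: kclosedI => //; apply: kclosed_compl.
exists d; last exact: connect_trans (kswap_equiv c v ab) cd.
rewrite dE tocol_kswap swap_symdiff; congr swap; apply/setP => x.
rewrite !inE -/V; case: (boolP (connect _ v x)) => [h|_]; last by rewrite andbT addbF.
by rewrite andbF /=; apply/esym/(subsetP VK); rewrite inE.
Qed.

Lemma keq_kempe_equiv c d : keq (tocol c) (tocol d) -> kempe_equiv c d.
Proof.
suff H e : keq (tocol c) e -> exists2 d, tocol d = e & kempe_equiv c d.
  by case/H => d' /tocol_inj->.
elim=> [|{}e a b K _ [d' <- cd'] cl].
  by exists c => //; apply: kempe_equiv_refl.
have [d'' e'' h] := swap_kempe_equiv (leqnn _) cl.
by exists d'' => //; apply: connect_trans cd' h.
Qed.

End Bridge.

Theorem theorem3 (G : sgraph) (hG : max_degree G <= 3)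
    (c d : colouring G (max_degree G).+1) :
  kempe_equiv c d.
Proof.
(* [hG] serves as the bound on the number of colours: Delta <= 3 and Delta + 1 <= 4 are
   convertible. *)
apply: keq_kempe_equiv; apply: (@keq_subcubic _ _ _ (tocol c) (tocol d) (leqnn _) hG).
- exact: tocol_pcol.
- exact: tocol_pcol.
- by move=> x y; rewrite !tocol_isSome.
move=> x; rewrite ltnS; apply: leq_trans (leq_bigmax x).
by apply/subset_leq_card/subsetP => y; rewrite !inE tocol_isSome.
Qed.
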